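(* Let $T$ be an infinite rooted tree whose vertex degrees are bounded by a finite constant, and let $M$ be the transfer matrix of a $q$-state generalized clock model with state space $\Omega_0=\{0,1,\dots,q-1\}$, $q\ge 2$. Assume that all eigenvalues of $M$ are non-negative (recall that $M$ is non-increasing). Let $\lambda_1$ be the second largest eigenvalue of $M$, i.e. the largest eigenvalue of $M$ other than the simple eigenvalue $\lambda_0=1$. If $$\lambda_1\,\operatorname{br}T>1,$$ then the generalized clock model on $T$ with transfer matrix $M$ exhibits a robust phase transition, and if $$\lambda_1\,\operatorname{br}T<1,$$ then it does not exhibit a robust phase transition.
   Context: Tree and cutsets. $T=(V,E)$ is an infinite tree rooted at $o\in V$ with uniformly bounded vertex degrees, and $|v|$ is the graph distance from $v$ to $o$. A cutset $C$ is a finite set of vertices such that every self-avoiding infinite path starting from $o$ intersects $C$, and such that there are no $x,y\in C$ with $|x|<|y|$ and $x$ lying on the shortest path from $o$ to $y$. $C^i$ denotes the finite component of $T\setminus C$ (the one containing $o$, when $o\notin C$). The branching number is $$\operatorname{br}T:=\sup\Big\{\lambda:\ \inf_C\sum_{v\in C}\lambda^{-|v|}>0\Big\},$$ the infimum being over all cutsets $C$. Generalized clock model. Let $\Omega_0=\{0,\dots,q-1\}$ with $d(k,l)=1-\cos(2\pi(k-l)/q)$. The transfer matrix $M$ is a $q\times q$ stochastic matrix with strictly positive entries such that $M(k,l)=M(k+g,l+g)$ for all $k,l,g\in\mathbb{Z}_q$ (addition mod $q$), $M(0,j)=M(0,k)$ whenever $d(0,j)=d(0,k)$, and $M$ is non-increasing: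 $M(i,j)\le M(k,l)$ whenever $d(i,j)\ge d(k,l)$. The pair potential is $\Phi(i,j)=-\log M(i,j)$. Robust phase transition. For $u\in(0,1]$ and a cutset $C$ with $o\notin C$, let $\mu_C^{u,\Phi,+}$ be the probability measure on $\Omega_0^{C^i}$ given by $$\mu_C^{u,\Phi,+}(\omega)=\frac1Z\exp\Big(-\sum_{\{x,y\}\in E:\,x,y\in C^i}\Phi(\omega_x,\omega_y)-u\sum_{\{x,y\}\in E:\,x\in C^i,\,y\in C}\Phi(\omega_x,0)\Big),$$ with $Z$ the normalizing constant (the boundary condition is identically $0$, and the coupling on edges between $C^i$ and $C$ is weakened by the factor $u$). Let $p_{C,o}^{u,\Phi,+}$ be its marginal distribution at the root $o$, and let $\mathbf 1$ denote the equidistribution on $\Omega_0$. The model exhibits a robust phase transition if for every $u\in(0,1]$ $$\inf_C\|p_{C,o}^{u,\Phi,+}-\mathbf 1\|_\infty\neq 0,$$ the infimum being over all cutsets $C$ of $T$ (with $o\notin C$). *)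

(* Defs.v *)
From HB Require Import structures.
From mathcomp Require Import all_boot all_order all_algebra finmap.
From mathcomp Require Import all_classical all_reals all_analysis.

Set Implicit Arguments.
Unset Strict Implicit.
Unset Printing Implicit Defensive.

Import Order.TTheory GRing.Theory Num.Theory.
Local Open Scope classical_set_scope.
Local Open Scope ring_scope.

Section Tree.
Variables (V : choiceType) (adj : rel V).

(* Graphs are simple, so a cycle has at least three vertices; [ucycle] also
   accepts the closed walk [:: x; y] along a single edge. *)
Definition is_tree : Prop :=
  [/\ symmetric adj,
      irreflexive adj,
      forall x y, exists2 p, path adj x p & last x p = y
    & forall c, ucycle adj c -> (size c <= 2)%N].

Definition bounded_degree : Prop :=
  exists D : nat, forall v, ([set w | adj v w] #<= `I_D)%card.

(* As in [path], the walk is x :: p, so its length is [size p]. *)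
Definition geodesic (x y : V) (p : seq V) : Prop :=
  [/\ path adj x p, last x p = y
    & forall p', path adj x p' -> last x p' = y -> (size p <= size p')%N].

(* In a connected graph a geodesic always exists, and the default [::] of
   [xget] is not used. *)
Definition gdist (x y : V) : nat := size (xget [::] [set p | geodesic x y p]).

Definition infinite_path (x : V) (gamma : nat -> V) : Prop :=
  [/\ gamma 0%N = x, injective gamma & forall n, adj (gamma n) (gamma n.+1)].

Variable o : V.

Definition cutset (C : {fset V}) : Prop :=
  (forall gamma, infinite_path o gamma -> exists n, gamma n \in C) /\
  (forall x y, x \in C -> y \in C -> (gdist o x < gdist o y)%N ->
     ~ exists2 p, geodesic o y p & x \in o :: p).

Definition root_component (C : {fset V}) : set V :=
  [set v | exists p, [/\ path adj o p, last o p = v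
                       & {in o :: p, forall x, x \notin C}]].

(* In an infinite, locally finite tree the component of the root is finite
   (Koenig's lemma), so that [fset_set] does not take its default value. *)
Definition inside (C : {fset V}) : {fset V} := fset_set (root_component C).

(* Both extrema exist in R for an infinite tree with bounded degrees: [fset o]
   is a cutset, all sums are nonnegative, the set of admissible lambda contains
   1 and is bounded by the maximal degree. *)
Definition branching_number (R : realType) : R :=
  sup [set lambda : R | 0 < lambda /\
    0 < inf [set \sum_(v <- C) lambda ^- gdist o v | C in cutset]].

End Tree.

(* The states are the elements of 'Z_q, which is {0, ..., q - 1} with addition
   mod q for q >= 2; matrices indexed by 'Z_q have size (Zp_trunc q).+2. *)
Section ClockModel.
Variables (R : realType) (q : nat).
Local Notation matrixZq := ('M[R]_((Zp_trunc q).+2)).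

Definition clock_dist (k l : 'Z_q) : R :=
  1 - cos (2 * pi * ((k : nat)%:R - (l : nat)%:R) / q%:R).

Record clock_transfer_matrix (M : matrixZq) : Prop := ClockTransferMatrix {
  ctm_gt0 : forall k l, 0 < M k l;
  ctm_stochastic : forall k, \sum_l M k l = 1;
  ctm_invariant : forall k l g : 'Z_q, M k l = M (k + g) (l + g);
  ctm_dist : forall j k : 'Z_q,
    clock_dist 0 j = clock_dist 0 k -> M 0 j = M 0 k;
  ctm_nonincreasing : forall i j k l : 'Z_q,
    clock_dist k l <= clock_dist i j -> M i j <= M k l
}.

(* Transfer matrices are symmetric, so their eigenvalues are all real. *)
Definition second_largest_eigenvalue (M : matrixZq) (lambda1 : R) : Prop :=
  [/\ eigenvalue M lambda1, lambda1 != 1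
    & forall a, eigenvalue M a -> a != 1 -> a <= lambda1].

Definition potential (M : matrixZq) (i j : 'Z_q) : R := - ln (M i j).

Section Gibbs.
Variables (V : choiceType) (adj : rel V) (o : V).
Variables (M : matrixZq) (u : R) (C : {fset V}).
Local Notation Ci := (inside adj o C).

(* In a tree every edge has exactly one end that is closer to o; taking that end
   first counts each unordered edge {x, y} inside C^i once. *)
Definition energy (w : {ffun Ci -> 'Z_q}) : R :=
  \sum_(x : Ci) \sum_(y : Ci | adj (val x) (val y) &&
                              (gdist adj o (val x) < gdist adj o (val y))%N)
     potential M (w x) (w y)
  + u * \sum_(x : Ci) \sum_(y <- C | adj (val x) y) potential M (w x) 0.

Definition partition_function : R :=
  \sum_(w : {ffun Ci -> 'Z_q}) expR (- energy w).

Definition gibbs (w : {ffun Ci -> 'Z_q}) : R :=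
  expR (- energy w) / partition_function.

Definition root_marginal (k : 'Z_q) : R :=
  \sum_(w : {ffun Ci -> 'Z_q} | [exists x : Ci, (val x == o) && (w x == k)])
     gibbs w.

Definition root_deviation : R :=
  \big[Num.max/0]_(k : 'Z_q) `|root_marginal k - q%:R^-1|.

End Gibbs.

Definition robust_phase_transition (V : choiceType) (adj : rel V) (o : V)
    (M : matrixZq) : Prop :=
  forall u : R, 0 < u -> u <= 1 ->
    inf [set root_deviation adj o M u C |
          C in [set C | cutset adj o C /\ o \notin C]] != 0.

End ClockModel.

(* Main.v *)
(* The messages of the recursion on the tree are "cosine-monotone": they are
   nondecreasing functions of cos (2 pi k / q).  This cone is stable under
   products and, by reflection, under M, because M is non-increasing.  On the
   cone the single number
     magn f = (\sum_k cos (2 pi k / q) f k) / (\sum_k f k)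
   is comparable to the distance of the normalized f from equidistribution, and
   magn (M f) = lambda_1 magn f, since a maximal-slope argument identifies
   lambda_1 as the eigenvalue of the cosine.  To first order magn turns products
   into sums, hence magn at x is about lambda_1 times the sum of magn over the
   children of x as long as these are small, and positive correlations give a
   lower bound when they are not.  Cutsets on which \sum_v lambda^|v| is small
   (resp. bounded below), pruned so that they are minimal for a suitable
   property, then bound magn at the root from above (resp. below). *)
Require Import Defs.
From HB Require Import structures.
From mathcomp Require Import all_boot all_order all_algebra finmap.
From mathcomp Require Import all_classical all_reals all_analysis.
From mathcomp Require Import ring lra zify.

Set Implicit Arguments.
Unset Strict Implicit.
Unset Printing Implicit Defensive.

Import Order.TTheory GRing.Theory Num.Theory.
Local Open Scope classical_set_scope.
Local Open Scope ring_scope.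

(** * Trigonometry on Z_q *)

Section CyclicTrigonometry.
Variables (R : realType) (q : nat).
Hypothesis q_gt1 : (1 < q)%N.
Local Notation T := 'Z_q.

(** Errors accumulate over unboundedly many levels, so the linearization has to be accurate up to a
    factor [1 + delta] and not up to an additive constant. The quadratic remainder of a product is
    at most [delta] times the linear term once the total magnetization of the factors is below some
    [eta], whatever their number. The gap [d] between [lambda_1] and the comparison rate [lam] pays
    for this factor at each level, because [lambda_1 <= 1]. What remains is to stay in the linear
    regime, and there minimality of the cutset enters. In the subcritical case, minimality for a
    small total weight bounds the weight under an inner vertex by the weight of that vertex alone,
    so magnetizations that a small [u] makes small at the boundary remain small. In the
    supercritical case, minimality for magnetization at least [beta] makes all inner vertices small,
    while a vertex with one large child would itself be large. The rate [lam] is the inverse of the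
    parameter in the branching number. *)

Definition cosZ (k : T) : R := cos (2 * pi * (k : nat)%:R / q%:R).
Definition sinZ (k : T) : R := sin (2 * pi * (k : nat)%:R / q%:R).

Let q_neq0 : q%:R != 0 :> R.
Proof. by rewrite pnatr_eq0 -lt0n ltnW. Qed.

Lemma periodic_natmul (f : R -> R) (t : R) (n : nat) (x : R) :
  (forall x, f (x + t) = f x) -> f (x + t *+ n) = f x.
Proof.
move=> ft; elim: n => [|n IHn]; first by rewrite mulr0n addr0.
by rewrite mulrSr addrA ft.
Qed.

Lemma angle_mod (n : nat) :
  2 * pi * n%:R / q%:R = 2 * pi * (n %% q)%:R / q%:R + (pi *+ 2) *+ (n %/ q) :> R.
Proof.
rewrite {1}(divn_eq n q) natrD natrM -(mulr_natr (pi *+ 2)) -(mulr_natr pi 2).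
by field.
Qed.

Lemma cos_angle_mod (n : nat) :
  cos (2 * pi * (n %% q)%:R / q%:R) = cos (2 * pi * n%:R / q%:R) :> R.
Proof. by rewrite [in RHS]angle_mod periodic_natmul //; exact: cosD2pi. Qed.

Lemma sin_angle_mod (n : nat) :
  sin (2 * pi * (n %% q)%:R / q%:R) = sin (2 * pi * n%:R / q%:R) :> R.
Proof. by rewrite [in RHS]angle_mod periodic_natmul //; exact: sinD2pi. Qed.

Lemma valZ_add (k l : T) : ((k + l)%R : nat) = ((k + l)%N %% q)%N.
Proof. by rewrite -[X in (_ %% X)%N](Zp_cast q_gt1). Qed.

Lemma cosZD (k l : T) : cosZ (k + l) = cosZ k * cosZ l - sinZ k * sinZ l.
Proof.
by rewrite /cosZ valZ_add cos_angle_mod natrD mulrDr mulrDl cosD.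
Qed.

Lemma sinZD (k l : T) : sinZ (k + l) = sinZ k * cosZ l + cosZ k * sinZ l.
Proof.
by rewrite /sinZ valZ_add sin_angle_mod natrD mulrDr mulrDl sinD.
Qed.

Lemma cosZ0 : cosZ 0 = 1.
Proof. by rewrite /cosZ /= mulr0 mul0r cos0. Qed.

Lemma sinZ0 : sinZ 0 = 0.
Proof. by rewrite /sinZ /= mulr0 mul0r sin0. Qed.

Lemma cosZ_sqr_sinZ (k : T) : cosZ k ^+ 2 + sinZ k ^+ 2 = 1.
Proof. exact: cos2Dsin2. Qed.

(** The representative of [- k] is not the integer opposite of that of [k], so evenness of the
    cosine does not apply directly. The addition formulas at [k + (- k) = 0] are solved for
    [cosZ (- k)] instead. *)
Lemma cosZN (k : T) : cosZ (- k) = cosZ k.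
Proof.
have := cosZD k (- k); have := sinZD k (- k); rewrite subrr cosZ0 sinZ0 => e1 e2.
have := cosZ_sqr_sinZ k => e3.
have -> : cosZ (- k) = cosZ k * (cosZ k * cosZ (- k) - sinZ k * sinZ (- k)) +
   sinZ k * (sinZ k * cosZ (- k) + cosZ k * sinZ (- k)).
  rewrite -[LHS]mul1r -e3; ring.
by rewrite -e1 -e2; ring.
Qed.

Lemma sinZN (k : T) : sinZ (- k) = - sinZ k.
Proof.
have := cosZD k (- k); have := sinZD k (- k); rewrite subrr cosZ0 sinZ0 => e1 e2.
have := cosZ_sqr_sinZ k => e3.
have -> : sinZ (- k) = cosZ k * (sinZ k * cosZ (- k) + cosZ k * sinZ (- k)) -
   sinZ k * (cosZ k * cosZ (- k) - sinZ k * sinZ (- k)).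
  rewrite -[LHS]mul1r -e3; ring.
by rewrite -e1 -e2; ring.
Qed.

Lemma cosZ_le1 (k : T) : cosZ k <= 1.
Proof. exact: cos_le1. Qed.

Lemma normr_cosZ_le1 (k : T) : `|cosZ k| <= 1.
Proof. by rewrite ler_norml cos_geN1 cos_le1. Qed.

Lemma cosZ_lt1 (k : T) : k != 0 -> cosZ k < 1.
Proof.
move=> k0; rewrite lt_neqAle cosZ_le1 andbT; apply/eqP => ck1.
(* Half the angle of [k] lies strictly between 0 and pi, where the sine is positive; the
   double-angle formula turns [cosZ k = 1] into a vanishing sine. *)
pose x : R := pi * (k : nat)%:R / q%:R.
have kgt0 : (0 < (k : nat))%N by rewrite lt0n; apply: contra k0 => /eqP k0; exact/eqP/val_inj.
have kltq : ((k : nat) < q)%N by have := ltn_ord k; rewrite [X in (_ < X)%N](Zp_cast q_gt1).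
have q_gt0 : 0 < q%:R :> R by rewrite ltr0n ltnW.
have xb : 0 < x < pi.
  have kR : 0 < (k : nat)%:R :> R by rewrite ltr0n.
  apply/andP; split; first by rewrite /x divr_gt0// mulr_gt0// pi_gt0.
  by rewrite /x ltr_pdivrMr// ltr_pM2l ?pi_gt0// ltr_nat.
have := sin_gt0_pi xb.
have : cos (x *+ 2) = 1.
  by rewrite -ck1 /cosZ /x; congr cos; rewrite mulr2n; field.
rewrite cos_mulr2n; have := cos2Dsin2 x => e3 e4 s0.
have : sin x ^+ 2 = 0 by rewrite mulr2n in e4; lra.
by move/eqP; rewrite sqrf_eq0 gt_eqF.
Qed.

Lemma cosZM (a b s d : T) : a + b = s -> a - b = d ->
  cosZ a * cosZ b = (cosZ s + cosZ d) / 2.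
Proof. by move=> <- <-; rewrite !cosZD cosZN sinZN; field. Qed.

(** Both sides equal [-4 sin^2((k+l)/2 - x) sin((k+l)/2) sin((k-l)/2)]. Half-angles are not defined
    on ['Z_q], so all products of cosines are expanded into sums. *)
Lemma cosZ_reflection (k l x : T) :
  (cosZ (k - x) - cosZ (l - x)) * (cosZ x - cosZ (k + l - x)) =
  (1 - cosZ (k + l - x - x)) * (cosZ k - cosZ l).
Proof.
rewrite !mulrBl !mulrBr !mul1r.
rewrite (@cosZM (k - x) x k (k - x - x)); try by ring.
rewrite (@cosZM (k - x) (k + l - x) (k + k + l - x - x) (- l)); try by ring.
rewrite (@cosZM (l - x) x l (l - x - x)); try by ring.
rewrite (@cosZM (l - x) (k + l - x) (k + l + l - x - x) (- k)); try by ring.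
rewrite (@cosZM (k + l - x - x) k (k + k + l - x - x) (l - x - x)); try by ring.
rewrite (@cosZM (k + l - x - x) l (k + l + l - x - x) (k - x - x)); try by ring.
rewrite !cosZN; lra.
Qed.

(** [(1 - cosZ (k - l)) * (1 - cosZ (k + l))] is the square of [cosZ k - cosZ l], and by [cosZ_lt1]
    a factor vanishes only when its argument is 0. *)
Lemma cosZ_eq (k l : T) : cosZ k = cosZ l -> k = l \/ k = - l.
Proof.
move=> e.
have : (1 - cosZ (k - l)) * (1 - cosZ (k + l)) = 0.
  rewrite !cosZD cosZN sinZN e.
  have -> : (1 - (cosZ l * cosZ l - sinZ k * - sinZ l)) *
     (1 - (cosZ l * cosZ l - sinZ k * sinZ l)) =
     (1 - cosZ l ^+ 2) ^+ 2 - sinZ k ^+ 2 * sinZ l ^+ 2 by ring.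
  have := cosZ_sqr_sinZ k; have := cosZ_sqr_sinZ l; rewrite e => e1 e2.
  have -> : sinZ k ^+ 2 = 1 - cosZ l ^+ 2 by rewrite -e2; ring.
  have -> : sinZ l ^+ 2 = 1 - cosZ l ^+ 2 by rewrite -e1; ring.
  by ring.
move/eqP; rewrite mulf_eq0 => /orP[]; rewrite subr_eq0 eq_sym => h.
  left; apply/eqP; rewrite -subr_eq0; apply: contraLR h => h; apply: negbT.
  by rewrite lt_eqF // cosZ_lt1.
right; apply/eqP; rewrite -subr_eq0 opprK; apply: contraLR h => h; apply: negbT.
by rewrite lt_eqF // cosZ_lt1.
Qed.

Lemma sum_sinZ_even (f : T -> R) : (forall k, f (- k) = f k) ->
  \sum_k f k * sinZ k = 0.
Proof.
move=> fN; have : \sum_k f k * sinZ k = - \sum_k f k * sinZ k; last lra.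
rewrite -sumrN (reindex_inj (@oppr_inj T)) /=; apply: eq_bigr => k _.
by rewrite fN sinZN mulrN.
Qed.

(** Translation by 1 multiplies the sum by [cosZ 1 < 1], since the sines cancel by oddness. *)
Lemma sum_cosZ : \sum_k cosZ k = 0.
Proof.
have e : \sum_k cosZ k = cosZ 1 * \sum_k cosZ k.
  rewrite {1}(reindex_inj (@addIr T 1)) /=.
  under eq_bigr do rewrite cosZD.
  rewrite sumrB -mulr_suml -[X in _ - X]mulr_suml mulrC.
  have -> : \sum_k sinZ k = 0.
    rewrite -[RHS](@sum_sinZ_even (fun=> 1))//.
    by apply: eq_bigr => k _; rewrite mul1r.
  by rewrite mul0r subr0.
have c1 : cosZ 1 < 1 by apply: cosZ_lt1; rewrite oner_neq0.
have : (1 - cosZ 1) * \sum_k cosZ k = 0 by rewrite mulrBl mul1r -e subrr.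
move/eqP; rewrite mulf_eq0 => /orP[|/eqP//].
by rewrite subr_eq0 gt_eqF.
Qed.

End CyclicTrigonometry.

(** * Cosine-monotone functions *)

(** With [P] and [S] taken over the remaining factors, [\sum t <= 1] gives [|P - 1| <= 2 S], so the
    cross term [g i * (P - 1)] fits into the mixed term of [(t i + S) ^+ 2]. *)
Lemma prod_near1 (R : realType) (I : Type) (s : seq I) (g t : I -> R) :
  (forall i, `|g i| <= t i) -> \sum_(i <- s) t i <= 1 ->
  `|\prod_(i <- s) (1 + g i) - 1 - \sum_(i <- s) g i| <= (\sum_(i <- s) t i) ^+ 2.
Proof.
move=> gt; elim: s => [|i s IHs]; first by rewrite !big_nil subrr subr0 normr0 sqr_ge0.
rewrite !big_cons.
set P := \prod_(_ <- _) _ in IHs *; set G := \sum_(_ <- _) g _ in IHs *.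
set S := \sum_(_ <- _) t _ in IHs *.
have t0 j : 0 <= t j by apply: le_trans (gt j).
have S0 : 0 <= S by apply: sumr_ge0.
have GS : `|G| <= S by apply: le_trans (ler_norm_sum _ _ _) _; apply: ler_sum.
move=> tS; have := IHs _ => /(_ ltac:(have := t0 i; lra)) PS.
have -> : (1 + g i) * P - 1 - (g i + G) = (P - 1 - G) + g i * (P - 1) by ring.
apply: le_trans (ler_normD _ _) _; rewrite normrM.
have P1 : `|P - 1| <= 2 * S.
  have -> : P - 1 = (P - 1 - G) + G by ring.
  apply: le_trans (ler_normD _ _) _.
  apply: le_trans (lerD PS GS) _; have := t0 i; nra.
have := ler_pM (normr_ge0 _) (normr_ge0 _) (gt i) P1.
have := t0 i; nra.
Qed.

Section Magnetization.
Variables (R : realType) (q : nat).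
Hypothesis q_gt1 : (1 < q)%N.
Local Notation T := 'Z_q.
Local Notation cosZ := (@cosZ R q).
Local Notation N := (#|{: T}|%:R : R).

Definition cos_mono (f : T -> R) := forall k l, cosZ k <= cosZ l -> f k <= f l.

Definition magn (f : T -> R) : R := (\sum_k cosZ k * f k) / \sum_k f k.

Lemma cos_mono_even (f : T -> R) : cos_mono f -> forall k, f (- k) = f k.
Proof. by move=> fm k; apply/eqP; rewrite eq_le !fm// cosZN. Qed.

Lemma cos_mono_max (f : T -> R) k : cos_mono f -> f k <= f 0.
Proof. by move=> fm; apply: fm; rewrite cosZ0 cosZ_le1. Qed.

Lemma cos_mono_prod (I : Type) (s : seq I) (f : I -> T -> R) :
  (forall i, cos_mono (f i)) -> (forall i k, 0 < f i k) ->
  cos_mono (fun k => \prod_(i <- s) f i k).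
Proof.
move=> fm f0 k l ckl; apply: ler_prod => i _.
by rewrite ltW//= fm.
Qed.

(** Up to normalization, both sides are twice the covariance of [B] and [C] under the weights [A];
    the left side writes it with two independent copies. *)
Lemma chebyshev_sum (A B C : T -> R) :
  \sum_k \sum_l A k * A l * ((B k - B l) * (C k - C l)) =
  2 * ((\sum_k B k * (C k * A k)) * (\sum_k A k) -
       (\sum_k B k * A k) * (\sum_k C k * A k)).
Proof.
transitivity (\sum_k ((B k * (C k * A k)) * (\sum_l A l) +
    A k * (\sum_l B l * (C l * A l)) - (B k * A k) * (\sum_l C l * A l)
    - (C k * A k) * (\sum_l B l * A l))).
  apply: eq_bigr => k _; rewrite !mulr_sumr -!sumrN -!big_split /=.
  by apply: eq_bigr => l _; ring.
rewrite !big_split /= !sumrN -!mulr_suml; ring.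
Qed.

Lemma chebyshev_term_ge0 (f : T -> R) k l : cos_mono f ->
  0 <= (cosZ k - cosZ l) * (f k - f l).
Proof.
move=> fm; have [c|c] := leP (cosZ k) (cosZ l).
  by have := fm _ _ c => h; nra.
by have := fm _ _ (ltW c) => h; nra.
Qed.

Lemma sumZ_gt0 (f : T -> R) : (forall k, 0 < f k) -> 0 < \sum_k f k.
Proof.
move=> f0; rewrite (bigD1 0)//=; apply: ltr_wpDr => //.
by apply: sumr_ge0 => k _; exact: ltW.
Qed.

(** Under the weights [f], the functions [cosZ] and [g] are ordered alike, so their covariance is
    nonnegative. This is the positive correlation that later allows all children but one to be
    discarded. *)
Lemma magnM_ge (f g : T -> R) : (forall k, 0 < f k) -> (forall k, 0 < g k) ->
  cos_mono g -> magn f <= magn (fun k => g k * f k).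
Proof.
move=> f0 g0 gm.
have gf0 : 0 < \sum_k g k * f k by apply: sumZ_gt0 => k; rewrite mulr_gt0.
rewrite /magn ler_pdivrMr ?sumZ_gt0// mulrAC ler_pdivlMr//.
rewrite -subr_ge0 -(@pmulr_rge0 _ 2)// -chebyshev_sum.
do 2![apply: sumr_ge0 => ? _].
by rewrite mulr_ge0 ?chebyshev_term_ge0// mulr_ge0// ltW.
Qed.

Lemma magn_ge0 (f : T -> R) : (forall k, 0 < f k) -> cos_mono f -> 0 <= magn f.
Proof.
move=> f0 fm; have := @magnM_ge (fun=> 1) f.
rewrite {1}/magn (eq_bigr cosZ) => [|k _]; last by rewrite mulr1.
rewrite sum_cosZ// mul0r /magn.
under eq_bigr do rewrite mulr1.
under [X in _ / X]eq_bigr do rewrite mulr1.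
by apply.
Qed.

Lemma magnZ (a : R) (f : T -> R) : a != 0 -> magn (fun k => a * f k) = magn f.
Proof.
move=> a0; rewrite /magn.
under eq_bigr do rewrite mulrCA.
by rewrite -!mulr_sumr -mulf_div divff// mul1r.
Qed.

Lemma card_Zq_gt0 : 0 < N.
Proof. by rewrite ltr0n card_ord. Qed.

(** The sum dominates every [(1 - cosZ l)^-1] with [l != 0]; its term at 0 is [0^-1 = 0]. *)
Definition osc_const : R := N * (1 + \sum_(k : T) (1 - cosZ k)^-1).

Lemma osc_const_gt0 : 0 < osc_const.
Proof.
rewrite /osc_const mulr_gt0 ?card_Zq_gt0// ltr_wpDr// sumr_ge0// => k _.
by rewrite invr_ge0 subr_ge0 cosZ_le1.
Qed.

(** With unit weights, the double sum of [chebyshev_sum] for [cosZ] and [p] is [2 N magn p]. Its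
    terms are nonnegative, so it suffices to keep the pairs [(0, l)] and [(l, 0)]. *)
Lemma osc_le (p : T -> R) l : cos_mono p -> \sum_k p k = 1 ->
  p 0 - p l <= osc_const * magn p.
Proof.
move=> pm p1.
have [->|l0] := eqVneq l 0.
  rewrite subrr mulr_ge0 ?(ltW osc_const_gt0)//.
  rewrite /magn p1 divr1.
  have := chebyshev_sum (fun=> 1) cosZ p.
  under [X in _ = _ * (_ - X * _) -> _]eq_bigr do rewrite mulr1.
  rewrite sum_cosZ// mul0r subr0.
  under [X in _ = _ * (X * _) -> _]eq_bigr do rewrite mulr1.
  rewrite sumr_const => e.
  have : 0 <= 2 * ((\sum_i cosZ i * p i) * N).
    rewrite -e; do 2![apply: sumr_ge0 => ? _].
    by rewrite !mul1r chebyshev_term_ge0.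
  by rewrite pmulr_rge0// pmulr_lge0// card_Zq_gt0.
have e : \sum_k \sum_j (cosZ k - cosZ j) * (p k - p j) = 2 * (magn p * N).
  rewrite /magn p1 divr1.
  have := chebyshev_sum (fun=> 1) cosZ p.
  under [X in _ = _ * (_ - X * _) -> _]eq_bigr do rewrite mulr1.
  rewrite sum_cosZ// mul0r subr0.
  under [X in _ = _ * (X * _) -> _]eq_bigr do rewrite mulr1.
  rewrite sumr_const => <-.
  by under [RHS]eq_bigr do under eq_bigr do rewrite mulr1 mul1r.
have t k j : 0 <= (cosZ k - cosZ j) * (p k - p j) by exact: chebyshev_term_ge0.
have cl : 0 < 1 - cosZ l by rewrite subr_gt0 cosZ_lt1.
have : (p 0 - p l) * (1 - cosZ l) <= magn p * N.
  have : 2 * ((p 0 - p l) * (1 - cosZ l)) <= 2 * (magn p * N); last lra.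
  rewrite -e (bigD1 0)//= (bigD1 l)//= [X in _ <= _ + X](bigD1 l)//=.
  rewrite [X in _ <= _ + (X + _)](bigD1 0)//= cosZ0.
  have a1 : 0 <= \sum_(i < (Zp_trunc q).+2 | i != l) (1 - cosZ i) * (p 0 - p i).
    by apply: sumr_ge0 => i _; have := t 0 i; rewrite cosZ0.
  have a2 : 0 <= \sum_(i < (Zp_trunc q).+2 | i != 0) (cosZ l - cosZ i) * (p l - p i).
    by apply: sumr_ge0 => i _; exact: t.
  have a3 : 0 <= \sum_(i < (Zp_trunc q).+2 | (i != 0) && (i != l))
      \sum_j (cosZ i - cosZ j) * (p i - p j).
    by apply: sumr_ge0 => i _; apply: sumr_ge0 => j _; exact: t.
  lra.
rewrite -ler_pdivlMr// => h; apply: le_trans h _.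
have m0 : 0 <= magn p.
  rewrite -(@pmulr_lge0 _ N) ?card_Zq_gt0// -(@pmulr_rge0 _ 2)// -e.
  by do 2![apply: sumr_ge0 => ? _]; exact: t.
have -> : osc_const * magn p = magn p * N * (1 + \sum_(k : T) (1 - cosZ k)^-1).
  by rewrite /osc_const; ring.
have mN : 0 <= magn p * N := mulr_ge0 m0 (ltW card_Zq_gt0).
rewrite ler_wpM2l//.
rewrite (bigD1 l)//= addrCA lerDl addr_ge0// sumr_ge0// => i _.
by rewrite invr_ge0 subr_ge0 cosZ_le1.
Qed.

(** [p k - N^-1] is the average over [l] of [p k - p l], and by [osc_le] all values lie within
    [osc_const * magn p] of the maximum [p 0]. *)
Lemma deviation_le (p : T -> R) k : cos_mono p -> \sum_k p k = 1 ->
  `|p k - N^-1| <= osc_const * magn p.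
Proof.
move=> pm p1.
have N0 := card_Zq_gt0.
have h l : `|p k - p l| <= osc_const * magn p.
  rewrite ler_norml; have := osc_le k pm p1; have := osc_le l pm p1.
  have := cos_mono_max k pm; have := cos_mono_max l pm; lra.
have -> : p k - N^-1 = N^-1 * \sum_l (p k - p l).
  rewrite sumrB p1 sumr_const mulrBr mulr1; congr (_ - _).
  by rewrite -[p k *+ _]mulr_natr mulrCA mulVf ?mulr1// gt_eqF.
rewrite normrM ger0_norm ?invr_ge0 ?(ltW N0)//.
rewrite mulrC ler_pdivrMr//.
apply: le_trans (ler_norm_sum _ _ _) _.
apply: le_trans (ler_sum _ (fun l _ => h l)) _.
by rewrite sumr_const mulr_natr.
Qed.

Lemma cos_monoZ (a : R) (f : T -> R) : 0 <= a -> cos_mono f ->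
  cos_mono (fun k => a * f k).
Proof. by move=> a0 fm k l c; rewrite ler_wpM2l// fm. Qed.

(** Dividing each factor by its mean gives [1 + g i], where [g i] has sum zero and size at most
    [K * magn (f i)]. In the expanded product the linear part contributes exactly [N * A] to the
    numerator and nothing to the denominator; [prod_near1] bounds the rest. *)
Lemma magn_prod (delta : R) : 0 < delta -> exists2 eta, 0 < eta &
  forall (I : Type) (s : seq I) (f : I -> T -> R),
    (forall i, cos_mono (f i)) -> (forall i k, 0 < f i k) ->
    \sum_(i <- s) magn (f i) <= eta ->
    `|magn (fun k => \prod_(i <- s) f i k) - \sum_(i <- s) magn (f i)|
       <= delta * \sum_(i <- s) magn (f i).
Proof.
move=> d0; set K := N * osc_const.
have N0 := card_Zq_gt0.
have K0 : 0 < K by rewrite mulr_gt0// osc_const_gt0.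
(* The three bounds on [A] give, in order: [A * |E0| <= |E0|]; [K * A <= 1 / 2], which permits
   [prod_near1] and keeps the denominator at least [3 N / 4]; [(K * A) ^+ 2 <= delta * A / 4], an
   error relative to [A]. *)
exists (Num.min 1 (Num.min (2 * K)^-1 (delta / (4 * K ^+ 2)))).
  by rewrite !lt_min ltr01 invr_gt0 mulr_gt0//= divr_gt0// mulr_gt0// exprn_gt0.
move=> I s f fm f0; set A := \sum_(_ <- _) _.
rewrite !le_min => /and3P[A1 AK Ad].
have A0 : 0 <= A by apply: sumr_ge0 => i _; apply: magn_ge0.
pose F i := \sum_k f i k.
have F0 i : 0 < F i by exact: sumZ_gt0.
pose g i k := N / F i * f i k - 1.
have gK i k : `|g i k| <= K * magn (f i).
  have := @deviation_le (fun k => (F i)^-1 * f i k) k.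
  rewrite magnZ ?gt_eqF ?invr_gt0// -mulr_sumr mulVf ?gt_eqF//.
  move=> /(_ (cos_monoZ _ (fm i)) erefl); rewrite invr_ge0 ltW// => /(_ erefl) h.
  have -> : g i k = N * ((F i)^-1 * f i k - N^-1).
    by rewrite /g mulrBr divff ?gt_eqF// mulrA.
  by rewrite normrM gtr0_norm// /K -mulrA ler_wpM2l// ltW.
have sg i : \sum_k g i k = 0.
  by rewrite /g sumrB -mulr_sumr sumr_const divfK ?gt_eqF// subrr.
have cg i : \sum_k cosZ k * g i k = N * magn (f i).
  under eq_bigr do rewrite /g mulrBr mulr1 mulrCA.
  by rewrite sumrB sum_cosZ// subr0 -mulr_sumr /magn mulrAC mulrA.
pose s1 := K * A.
have s1E : \sum_(i <- s) K * magn (f i) = s1 by rewrite /s1 /A mulr_sumr.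
have s1h : s1 <= 1 / 2.
  have : K * A <= K * (2 * K)^-1 by rewrite ler_wpM2l// ltW.
  by rewrite invfM mulrCA divff ?gt_eqF// mulr1 div1r.
have s10 : 0 <= s1 by rewrite mulr_ge0// ltW.
pose P k := \prod_(i <- s) (1 + g i k).
pose e k := P k - 1 - \sum_(i <- s) g i k.
have eb k : `|e k| <= s1 ^+ 2.
  rewrite -s1E; apply: prod_near1 => [i|]; first exact: gK.
  rewrite s1E; lra.
have PE k : P k = 1 + \sum_(i <- s) g i k + e k by rewrite /e; ring.
clearbody e.
have -> : magn (fun k => \prod_(i <- s) f i k) = magn P.
  have C0 : \prod_(i <- s) (N / F i) != 0.
    by rewrite gt_eqF//; apply: prodr_gt0 => i _; rewrite divr_gt0.
  rewrite -(magnZ _ C0); congr magn; apply/funext => k.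
  by rewrite -big_split; apply: eq_bigr => i _; rewrite /g addrC subrK.
pose E0 := \sum_k e k; pose E1 := \sum_k cosZ k * e k.
have sP : \sum_k P k = N + E0.
  under eq_bigr do rewrite PE.
  rewrite !big_split /= sumr_const [X in _ + X + _]exchange_big /=.
  by rewrite [X in _ + X + _]big1 ?addr0// => i _; exact: sg.
have cP : \sum_k cosZ k * P k = N * A + E1.
  under eq_bigr do rewrite PE 2!mulrDr mulr1 mulr_sumr.
  rewrite !big_split /= sum_cosZ// add0r; congr (_ + _).
  by rewrite exchange_big /= /A mulr_sumr; apply: eq_bigr => i _; exact: cg.
have E0b : `|E0| <= N * s1 ^+ 2.
  apply: le_trans (ler_norm_sum _ _ _) _.
  apply: le_trans (ler_sum _ (fun k _ => eb k)) _.
  by rewrite sumr_const mulr_natl.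
have E1b : `|E1| <= N * s1 ^+ 2.
  apply: le_trans (ler_norm_sum _ _ _) _.
  apply: (@le_trans _ _ (\sum_(k : T) s1 ^+ 2)).
    apply: ler_sum => k _; rewrite normrM -[leRHS]mul1r.
    by rewrite ler_pM// normr_cosZ_le1.
  by rewrite sumr_const mulr_natl.
have s12 : s1 ^+ 2 <= 1 / 4 by nra.
have D0 : N * (3 / 4) <= N + E0.
  move: E0b; rewrite ler_norml => /andP[+ _]; nra.
have Dp : 0 < N + E0 by nra.
rewrite /magn cP sP.
have -> : (N * A + E1) / (N + E0) - A = (E1 - A * E0) / (N + E0).
  by field; rewrite gt_eqF.
rewrite normrM normfV (gtr0_norm Dp) ler_pdivrMr//.
apply: (@le_trans _ _ (2 * (N * s1 ^+ 2))).
  apply: le_trans (ler_normB _ _) _; rewrite normrM (ger0_norm A0).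
  have := normr_ge0 E0; nra.
have s1d : s1 ^+ 2 <= delta * A / 4.
  have := ler_wpM2l (ltW K0) Ad.
  move/(ler_wpM2l (ltW K0))/(ler_wpM2l A0).
  have -> : A * (K * (K * (delta / (4 * K ^+ 2)))) = delta * A / 4.
    by field; rewrite gt_eqF.
  by rewrite /s1 => h; apply: le_trans h; rewrite le_eqVlt; apply/orP; left; apply/eqP; ring.
have dA : 0 <= delta * A by rewrite mulr_ge0// ltW.
nra.
Qed.
End Magnetization.

(** * The transfer matrix *)

Section TransferMatrix.
Variables (R : realType) (q : nat).
Hypothesis q_gt1 : (1 < q)%N.
Variable M : 'M[R]_((Zp_trunc q).+2).
Hypothesis clockM : clock_transfer_matrix M.
Local Notation T := 'Z_q.
Local Notation cosZ := (@cosZ R q).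
Local Notation sinZ := (@sinZ R q).

Definition transfer (f : T -> R) (k : T) : R := \sum_l M k l * f l.

Lemma transfer_matrixE (k l : T) : M k l = M 0 (l - k).
Proof. by rewrite (ctm_invariant clockM k l (- k)) subrr. Qed.

Lemma clock_dist0 (k : T) : clock_dist R 0 k = 1 - cosZ k.
Proof.
by rewrite /clock_dist /cosZ /= sub0r mulrN mulNr cosN.
Qed.

Lemma cos_mono_transfer_row : cos_mono (M 0).
Proof.
move=> k l c; apply: (ctm_nonincreasing clockM).
by rewrite !clock_dist0 lerD2l lerN2.
Qed.

Lemma transfer_matrix_sym (k l : T) : M k l = M l k.
Proof.
rewrite transfer_matrixE [RHS]transfer_matrixE -opprB.
by rewrite (cos_mono_even q_gt1 cos_mono_transfer_row).
Qed.

Lemma transfer_gt0 (f : T -> R) : (forall k, 0 < f k) -> forall k, 0 < transfer f k.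
Proof.
by move=> f0 k; apply: sumZ_gt0 => l; rewrite mulr_gt0// (ctm_gt0 clockM).
Qed.

(* The reflection x -> k + l - x exchanges k and l; by [cosZ_reflection], x is
   closer to l than to k exactly when it is closer to 0 than its mirror image. *)
Lemma cos_mono_transfer (f : T -> R) : cos_mono f -> cos_mono (transfer f).
Proof.
move=> fm k l c; rewrite -subr_ge0.
have mm := cos_mono_transfer_row.
have mN := cos_mono_even q_gt1 mm.
pose D x := M 0 (l - x) - M 0 (k - x).
have e1 : transfer f l - transfer f k = \sum_x D x * f x.
  rewrite /transfer -sumrB; apply: eq_bigr => x _.
  rewrite !(transfer_matrixE _ x) -mulrBl /D.
  by rewrite -(opprB l x) -(opprB k x) !mN.
have e2 : transfer f l - transfer f k = - \sum_x D x * f (k + l - x).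
  rewrite e1 (reindex_inj (inv_inj (subKr (k + l)))) /= -sumrN.
  apply: eq_bigr => x _; rewrite -mulNr /D opprB; congr (_ * _).
  have -> : l + (x - (k + l)) = - (k - x) by ring.
  have -> : k + (x - (k + l)) = - (l - x) by ring.
  by rewrite !mN opprB.
(* Adding [e1] and [e2] pairs each [x] with its mirror image: the terms become
   [D x * (f x - f (k + l - x))], each of which is nonnegative. *)
rewrite -(@pmulr_rge0 _ 2)// mulr_natl mulr2n {1}e1 e2 -sumrB.
apply: sumr_ge0 => x _; rewrite -mulrBr.
have := cosZ_reflection R q_gt1 k l x.
have r0 : 0 <= 1 - cosZ (k + l - x - x) by rewrite subr_ge0 cosZ_le1.
have c0 : cosZ k - cosZ l <= 0 by rewrite subr_le0.
move=> h.
have {}h : 0 <= (cosZ (l - x) - cosZ (k - x)) * (cosZ x - cosZ (k + l - x)).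
  by rewrite -(opprB (cosZ (k - x))) mulNr h -mulrN mulr_ge0// oppr_ge0.
rewrite /D; have [a|a|a] := ltgtP (cosZ (l - x)) (cosZ (k - x)).
- have b : cosZ x <= cosZ (k + l - x) by nra.
  by have := mm _ _ (ltW a); have := fm _ _ b => *; nra.
- have b : cosZ (k + l - x) <= cosZ x by nra.
  by have := mm _ _ (ltW a); have := fm _ _ b => *; nra.
- have -> : M 0 (l - x) = M 0 (k - x) by apply/eqP; rewrite eq_le !mm ?a.
  by rewrite subrr mul0r.
Qed.

Definition cos_eigenvalue : R := \sum_k M 0 k * cosZ k.

Lemma transfer_cosZ k : transfer cosZ k = cos_eigenvalue * cosZ k.
Proof.
rewrite /transfer (reindex_inj (@addIr T k)) /=.
under eq_bigr do rewrite transfer_matrixE addrK cosZD// mulrBr !mulrA.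
rewrite sumrB -!mulr_suml (sum_sinZ_even q_gt1) ?mul0r ?subr0//.
exact: (cos_mono_even q_gt1 cos_mono_transfer_row).
Qed.

Lemma sum_transfer (g f : T -> R) :
  \sum_k g k * transfer f k = \sum_k transfer g k * f k.
Proof.
rewrite /transfer; under eq_bigr do rewrite mulr_sumr.
rewrite exchange_big /=; apply: eq_bigr => k _; rewrite mulr_suml.
by apply: eq_bigr => l _; rewrite (transfer_matrix_sym k l); ring.
Qed.

Lemma sum_transfer1 (f : T -> R) : \sum_k transfer f k = \sum_k f k.
Proof.
transitivity (\sum_k 1 * transfer f k); first by apply: eq_bigr => *; rewrite mul1r.
rewrite (sum_transfer (fun=> 1)); apply: eq_bigr => k _.
rewrite /transfer; under eq_bigr do rewrite mulr1.
by rewrite (ctm_stochastic clockM) mul1r.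
Qed.

Lemma magn_transfer (f : T -> R) : magn (transfer f) = cos_eigenvalue * magn f.
Proof.
rewrite /magn sum_transfer1 sum_transfer mulrA mulr_sumr; congr (_ / _).
by apply: eq_bigr => k _; rewrite transfer_cosZ mulrA.
Qed.

(** [eigenvalue] concerns row vectors multiplied by [M] on the right; symmetry of [M] turns them
    into eigenfunctions of [transfer]. *)
Lemma eigenvalue_transferP (a : R) :
  reflect (exists2 f : T -> R, (forall k, transfer f k = a * f k) & exists k, f k != 0)
    (eigenvalue M a).
Proof.
apply: (iffP eigenvalueP) => [[v vM v0]|[f fM [k fk]]].
  exists (v 0) => [k|].
    have := congr1 (fun w : 'rV_ _ => w 0 k) vM; rewrite !mxE => <-.
    by apply: eq_bigr => l _; rewrite transfer_matrix_sym mulrC.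
  apply: contra_notP (elimN eqP v0) => h; apply/rowP => k; rewrite mxE.
  by apply: contra_notP h => /eqP vk; exists k.
exists (\row_k f k).
  apply/rowP => k'; rewrite !mxE -fM; apply: eq_bigr => l _.
  by rewrite mxE transfer_matrix_sym mulrC.
by apply/eqP => /rowP /(_ k); rewrite !mxE; exact/eqP.
Qed.

Lemma cos_eigenvalue_lt1 : cos_eigenvalue < 1.
Proof.
rewrite -(ctm_stochastic clockM 0) /cos_eigenvalue.
rewrite (bigD1 1)//= [ltRHS](bigD1 1)//=; apply: ltr_leD.
  rewrite -[ltRHS]mulr1 ltr_pM2l ?(ctm_gt0 clockM)// cosZ_lt1// oner_neq0.
by apply: ler_sum => k _; rewrite -[leRHS]mulr1 ler_pM2l ?(ctm_gt0 clockM)// cosZ_le1.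
Qed.

(* Let w be an even eigenfunction for a, and t its maximal slope with respect to
   the cosine. Then t cos - w is cosine-monotone, hence so is its image under M,
   which at the pair realizing t reads a t <= cos_eigenvalue t. *)
Lemma eigenvalue_le_cos_eigenvalue (a : R) :
  eigenvalue M a -> a != 1 -> a <= cos_eigenvalue.
Proof.
move=> /eigenvalue_transferP[f fM [k0 fk0]] a1.
(* Symmetrizing about [k0] makes [w] even, as cosine-monotone functions are, and the factor [f k0]
   ensures [w 0 = 2 (f k0)^2 > 0]. *)
pose w k := f k0 * (f (k0 + k) + f (k0 - k)).
have transl k : transfer (fun x => f (k0 + x)) k = a * f (k0 + k).
  rewrite -fM /transfer [RHS](reindex_inj (@addrI T k0)) /=.
  apply: eq_bigr => x _; rewrite transfer_matrixE [in RHS]transfer_matrixE.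
  by congr (M 0 _ * _); ring.
have transN k : transfer (fun x => f (k0 - x)) k = a * f (k0 - k).
  rewrite -transl /transfer [RHS](reindex_inj (@oppr_inj T)) /=.
  apply: eq_bigr => x _; rewrite transfer_matrixE [in RHS]transfer_matrixE.
  rewrite -(cos_mono_even q_gt1 cos_mono_transfer_row (x - k)).
  by congr (M 0 _ * _); ring.
have wM k : transfer w k = a * w k.
  rewrite /w mulrCA mulrDr -transl -transN -big_split mulr_sumr /=.
  by apply: eq_bigr => x _; ring.
have wN k : w (- k) = w k by rewrite /w opprK addrC.
have w0 : 0 < w 0.
  rewrite /w addr0 subr0 mulrDr -expr2 addr_gt0// lt_neqAle eq_sym sqrf_eq0.
    by rewrite fk0 sqr_ge0.
  by rewrite fk0 sqr_ge0.
have sw : \sum_k w k = 0.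
  have : \sum_k w k = a * \sum_k w k.
    by rewrite -{1}sum_transfer1 mulr_sumr; apply: eq_bigr => k _.
  move/eqP; rewrite -subr_eq0 -{1}[\sum__ _]mul1r -mulrBl mulf_eq0 subr_eq0 eq_sym.
  by rewrite (negbTE a1) => /eqP.
have [l wl] : exists l, w l < 0.
  apply/not_existsP => h; have : 0 < \sum_k w k.
    rewrite (bigD1 0)//=; apply: ltr_wpDr => //; apply: sumr_ge0 => k _.
    by rewrite leNgt; apply/negP.
  by rewrite sw ltxx.
have l0 : l != 0 by apply: contraTneq wl => ->; rewrite -leNgt ltW.
have c0l : cosZ l < cosZ 0 by rewrite cosZ0 cosZ_lt1.
pose rho (kl : T * T) := (w kl.1 - w kl.2) / (cosZ kl.1 - cosZ kl.2).
have [[k1 k2] /= k12 rmax] :=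
  @arg_maxP _ _ _ (0, l) [pred kl : T * T | cosZ kl.2 < cosZ kl.1] rho c0l.
set t := rho (k1, k2) in rmax.
have t0 : 0 < t.
  apply: lt_le_trans (rmax (0, l) c0l).
  rewrite /rho /= divr_gt0 ?subr_gt0//; exact: lt_trans w0.
(* The maximal slope controls only pairs with distinct cosines; for equal cosines [cosZ_eq] and the
   evenness of [w] take over. *)
have um : cos_mono (fun k => t * cosZ k - w k).
  move=> k k' ckk; have [ck|ck] := eqVneq (cosZ k) (cosZ k').
    by rewrite ck; case: (cosZ_eq q_gt1 ck) => ->; rewrite ?wN.
  have clt : cosZ k < cosZ k' by rewrite lt_neqAle ck.
  have := rmax (k', k) clt; rewrite /rho /= ler_pdivrMr ?subr_gt0//; lra.
have tM k : transfer (fun k => t * cosZ k - w k) k =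
    t * (cos_eigenvalue * cosZ k) - a * w k.
  rewrite -transfer_cosZ -wM /transfer mulr_sumr -sumrB.
  by apply: eq_bigr => x _; ring.
have := cos_mono_transfer um (ltW k12); rewrite !tM.
have : w k1 - w k2 = t * (cosZ k1 - cosZ k2).
  by rewrite /t /rho /= divfK// gt_eqF// subr_gt0.
have d0 : 0 < t * (cosZ k1 - cosZ k2) by rewrite mulr_gt0// subr_gt0.
move=> e h.
have : a * (t * (cosZ k1 - cosZ k2)) <= cos_eigenvalue * (t * (cosZ k1 - cosZ k2)).
  by rewrite -{1}e; lra.
by rewrite ler_pM2r.
Qed.

Lemma second_largest_eigenvalueE (lambda1 : R) :
  second_largest_eigenvalue M lambda1 -> lambda1 = cos_eigenvalue.
Proof.
move=> [ev1 ne1 max1]; apply/eqP; rewrite eq_le.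
rewrite eigenvalue_le_cos_eigenvalue//= max1//.
  apply/eigenvalue_transferP; exists cosZ; first exact: transfer_cosZ.
  by exists 0; rewrite cosZ0 oner_neq0.
by rewrite lt_eqF// cos_eigenvalue_lt1.
Qed.

End TransferMatrix.

(** * Messages sent by the vertices of the cutset *)

Section BoundaryMessage.
Variables (R : realType) (q : nat).
Hypothesis q_gt1 : (1 < q)%N.
Variable M : 'M[R]_((Zp_trunc q).+2).
Hypothesis clockM : clock_transfer_matrix M.
Local Notation T := 'Z_q.
Local Notation cosZ := (@cosZ R q).
Local Notation N := (#|{: T}|%:R : R).

(** This is [M k 0] to the power [u], the weight of an edge from an inner vertex in state [k] to the
    cutset. *)
Definition boundary_message (u : R) (k : T) : R := expR (- (u * potential M k 0)).

Lemma boundary_messageE u k : boundary_message u k = expR (u * ln (M k 0)).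
Proof. by rewrite /boundary_message /potential mulrN opprK. Qed.

Lemma boundary_message_gt0 u k : 0 < boundary_message u k.
Proof. exact: expR_gt0. Qed.

Lemma cos_mono_boundary_message u : 0 <= u -> cos_mono (boundary_message u).
Proof.
move=> u0 k l c; rewrite !boundary_messageE ler_expR ler_wpM2l// ler_ln ?posrE ?(ctm_gt0 clockM)//.
rewrite !(transfer_matrix_sym q_gt1 clockM _ 0).
exact: (cos_mono_transfer_row clockM).
Qed.

(** Zero magnetization would make the message constant by [deviation_le], hence row 0 of [M]
    constant as [u != 0], and then [cos_eigenvalue M] would vanish. *)
Lemma magn_boundary_message_gt0 u : 0 < u -> 0 < cos_eigenvalue M ->
  0 < magn (boundary_message u).
Proof.
move=> u0 lam0; have B0 := boundary_message_gt0 u.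
have Bm := cos_mono_boundary_message (ltW u0).
rewrite lt_neqAle magn_ge0// andbT eq_sym; apply/eqP => m0.
have S0 := sumZ_gt0 B0; set S := \sum__ _ in S0.
have Bc k : boundary_message u k = S / N.
  have := @deviation_le _ _ q_gt1 (fun k => S^-1 * boundary_message u k) k.
  rewrite magnZ ?gt_eqF ?invr_gt0// -mulr_sumr mulVf ?gt_eqF// m0 mulr0.
  move=> /(_ (cos_monoZ _ Bm) erefl); rewrite invr_ge0 ltW// => /(_ erefl).
  rewrite normr_le0 subr_eq0 => /eqP e; rewrite -e mulrA divff ?mul1r// gt_eqF//.
have Mc k : M 0 k = M 0 0.
  have := Bc k; rewrite -(Bc 0) !boundary_messageE => /expR_inj /(mulfI (lt0r_neq0 u0)).
  rewrite transfer_matrix_sym// => /ln_inj; rewrite !posrE !(ctm_gt0 clockM).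
  by rewrite transfer_matrix_sym//; apply.
move: lam0; rewrite /cos_eigenvalue; under eq_bigr do rewrite Mc.
by rewrite -mulr_sumr sum_cosZ// mulr0 ltxx.
Qed.

Lemma magn_boundary_message_small (e : R) : 0 < e ->
  exists u, [/\ 0 < u, u <= 1 & magn (boundary_message u) <= e].
Proof.
move=> e0.
have lnM k : ln (M k 0) <= 0.
  apply: ln_le0; rewrite -(ctm_stochastic clockM k) (bigD1 0)//= lerDl.
  by apply: sumr_ge0 => l _; rewrite ltW// (ctm_gt0 clockM).
pose L : R := 1 + \sum_k - ln (M k 0).
have L0 : 0 < L by rewrite ltr_wpDr// sumr_ge0// => k _; rewrite oppr_ge0.
have lnL k : - L <= ln (M k 0).
  rewrite lerNl /L (bigD1 k)//= addrCA lerDl addr_ge0// sumr_ge0// => l _.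
  by rewrite oppr_ge0.
(* [L] bounds every [- ln (M k 0)]. With [u * L <= 1 / 2] the denominator of [magn] is at least
   [N / 2]; the numerator is at most [N * (u * L)], so the quotient is at most
   [2 * (u * L) <= e]. *)
exists (Num.min 1 (Num.min (2 * L)^-1 (e / (2 * L)))); set u := Num.min _ _.
have : u <= u by []. rewrite {2}/u !le_min => /and3P[u1 uL ue].
have u0 : 0 < u.
  by rewrite /u !lt_min ltr01 invr_gt0 mulr_gt0//= divr_gt0// mulr_gt0.
split => //.
have uL2 : u * L <= 1 / 2.
  by rewrite -ler_pdivlMr// (le_trans uL)// div1r invfM.
have ueL : 2 * (u * L) <= e.
  by move: ue; rewrite ler_pdivlMr ?mulr_gt0// mulrCA.
have Blo k : 1 - u * L <= boundary_message u k.
  rewrite boundary_messageE; apply: le_trans (expR_ge1Dx _).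
  by rewrite lerD2l -mulrN ler_wpM2l// ltW.
have Bhi k : boundary_message u k <= 1.
  by rewrite boundary_messageE -expR0 ler_expR mulr_ge0_le0// ltW.
have N0 := @card_Zq_gt0 R q.
have SB : N / 2 <= \sum_k boundary_message u k.
  apply: (@le_trans _ _ (\sum_(k : T) (1 / 2))).
    by rewrite sumr_const mulr_natl div1r.
  by apply: ler_sum => k _; have := Blo k; lra.
rewrite /magn ler_pdivrMr ?sumZ_gt0//; last exact: boundary_message_gt0.
apply: (@le_trans _ _ (N * (u * L))).
  have -> : \sum_k cosZ k * boundary_message u k =
      \sum_k cosZ k * (boundary_message u k - 1).
    rewrite [RHS](eq_bigr (fun k => cosZ k * boundary_message u k - cosZ k)).
      by rewrite sumrB sum_cosZ// subr0.
    by move=> k _; rewrite mulrBr mulr1.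
  apply: (@le_trans _ _ (\sum_(k : T) (u * L))); last by rewrite sumr_const mulr_natl.
  apply: ler_sum => k _; apply: le_trans (ler_norm _) _.
  rewrite normrM -[leRHS]mul1r ler_pM// ?normr_cosZ_le1// ler_norml.
  have := Blo k; have := Bhi k; have : 0 <= u * L by rewrite mulr_ge0// ltW.
  lra.
nra.
Qed.
End BoundaryMessage.

(** * Rooted trees and cutsets *)

Section RootedTree.
Variables (V : choiceType) (adj : rel V) (o : V).
Hypothesis treeT : is_tree adj.

Local Notation depth := (gdist adj o).

Let adj_sym : symmetric adj. Proof. by case: treeT. Qed.
Let adj_irr : irreflexive adj. Proof. by case: treeT. Qed.

Lemma geodesic_ex x y : exists p, geodesic adj x y p.
Proof.
case: treeT => _ _ conn _; have [p pp lp] := conn x y.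
pose Q n := `[< exists p, [/\ path adj x p, last x p = y & size p = n] >].
have exQ : exists n, Q n by exists (size p); apply/asboolP; exists p.
have [n /asboolP[p' [pp' lp' <-]] minn] := ex_minnP exQ.
exists p'; split => // p'' pp'' lp''; apply: minn; apply/asboolP; by exists p''.
Qed.

Lemma gdistP x y : exists2 p, geodesic adj x y p & gdist adj x y = size p.
Proof.
have [p gp] := geodesic_ex x y; rewrite /gdist.
exists (xget [::] [set p | geodesic adj x y p]) => //.
exact: (@xgetPex _ [::] [set p | geodesic adj x y p] (ex_intro _ p gp)).
Qed.

Lemma gdist_le x p : path adj x p -> (gdist adj x (last x p) <= size p)%N.
Proof. by move=> pp; have [p' [_ _ h] ->] := gdistP x (last x p); exact: h. Qed.

Lemma depth_root : depth o = 0%N.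
Proof. by apply/eqP; rewrite -leqn0 (@gdist_le o [::]). Qed.

Lemma depth_eq0 v : depth v = 0%N -> v = o.
Proof.
by have [p [_ <- _] ->] := gdistP o v => /size0nil ->.
Qed.

Lemma depth_adj x y : adj x y -> (depth y <= (depth x).+1)%N.
Proof.
move=> xy; have [p [pp lp _] ->] := gdistP o x.
have := @gdist_le o (rcons p y); rewrite rcons_path lp pp xy last_rcons size_rcons.
by apply.
Qed.

Lemma parent_ex v : v != o -> exists2 u, adj u v & (depth u).+1 = depth v.
Proof.
move=> vo; have [p] := gdistP o v; case: (lastP p) => [|p' w] [pp lp _] sp.
  by rewrite -lp eqxx in vo.
move: pp lp sp; rewrite rcons_path last_rcons size_rcons => /andP[pp aw] wv sp.
subst w; exists (last o p') => //; apply/eqP; rewrite eqn_leq depth_adj// andbT.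
by rewrite sp ltnS gdist_le.
Qed.

Lemma walk_to_root y : exists p, [/\ path adj y p, last y p = o &
  {in p, forall z, (depth z < depth y)%N}].
Proof.
have [n] := ubnP (depth y); elim: n y => // n IHn y /ltnSE yn.
have [->|yo] := eqVneq y o; first by exists [::].
have [u uy du] := parent_ex yo.
have [p [pp lp hp]] := IHn u ltac:(lia).
exists (u :: p); split => //=; first by rewrite adj_sym uy.
move=> z; rewrite inE => /predU1P[->|/hp]; lia.
Qed.

(* The walks from y1 and y2 to the root avoid x, so that distinct y1 and y2
   would put x on a cycle. *)
Lemma lower_neighbor_unique x y1 y2 : adj x y1 -> adj x y2 ->
  (depth y1 <= depth x)%N -> (depth y2 <= depth x)%N -> y1 = y2.
Proof.
move=> a1 a2 d1 d2; apply/eqP/negPn/negP => y12.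
have [p1 [pp1 lp1 h1]] := walk_to_root y1; have [p2 [pp2 lp2 h2]] := walk_to_root y2.
have avoid y p : adj x y -> (depth y <= depth x)%N ->
    {in p, forall z, (depth z < depth y)%N} -> x \notin y :: p.
  move=> ay dy h; rewrite inE negb_or; apply/andP; split.
    by apply: contraTneq ay => ->; rewrite adj_irr.
  by apply/negP => /h; lia.
pose r := rev (belast y2 p2).
have pr : path adj o r.
  rewrite /r -lp2 rev_path; move: pp2; apply: sub_path => a b /=; by rewrite adj_sym.
have lr : last o r = y2.
  rewrite /r; case: (p2) lp2 => [/= <-//|z p2' _].
  by rewrite /= rev_cons last_rcons.
have pw : path adj y1 (p1 ++ r) by rewrite cat_path pp1 lp1.
have lw : last y1 (p1 ++ r) = y2 by rewrite last_cat lp1.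
have xw : x \notin y1 :: (p1 ++ r).
  rewrite -cat_cons mem_cat negb_or avoid//= /r mem_rev.
  by apply: contra (avoid _ _ a2 d2 h2) => /mem_belast.
case/shortenP: pw lw => p' pp' up' sp' lp'.
have xp' : x \notin y1 :: p'.
  move: xw; rewrite !inE !negb_or => /andP[-> /=].
  by apply: contra => /sp'.
have cyc : ucycle adj (x :: y1 :: p').
  apply/andP; split; last by rewrite cons_uniq xp'.
  by rewrite /= a1 rcons_path pp' lp' adj_sym a2.
case: treeT => _ _ _ /(_ _ cyc) /=.
by case: p' lp' {cyc pp' up' sp' xp'} => // e; rewrite -e eqxx in y12.
Qed.

(** The root is its own parent, so iteration of [parent] ends at [o]. Elsewhere [xget] has a single
    candidate by [lower_neighbor_unique]. *)
Definition parent (v : V) : V :=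
  if v == o then o else xget o [set u | adj u v /\ (depth u < depth v)%N].

Lemma parent_root : parent o = o.
Proof. by rewrite /parent eqxx. Qed.

Lemma parentP v : v != o -> adj (parent v) v /\ (depth (parent v)).+1 = depth v.
Proof.
move=> vo; have [u uv du] := parent_ex vo.
have := @xgetPex _ o [set u | adj u v /\ (depth u < depth v)%N].
rewrite /parent (negbTE vo) => /(_ _)[|a d].
  by exists u; split => //; lia.
by split => //; have := depth_adj a; lia.
Qed.

Lemma depth_parent v : depth (parent v) = (depth v).-1.
Proof.
have [->|vo] := eqVneq v o; first by rewrite parent_root depth_root.
by have [_ <-] := parentP vo.
Qed.

Definition child (x y : V) : bool := adj x y && (depth x < depth y)%N.

Lemma childE x y : child x y = (y != o) && (parent y == x).
Proof.
apply/andP/andP => [[a d]|[yo /eqP <-]]; last first.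
  by have [? e] := parentP yo; split => //; rewrite -e.
have yo : y != o by apply: contraTneq d => ->; rewrite depth_root.
have [a' e] := parentP yo; split => //; apply/eqP.
apply: (@lower_neighbor_unique y); rewrite 1?adj_sym//; lia.
Qed.

Lemma depth_child x y : child x y -> depth y = (depth x).+1.
Proof. by rewrite childE => /andP[yo /eqP <-]; have [_ ->] := parentP yo. Qed.

(** An edge between equal depths would give [x] two distinct neighbors that are not deeper than [x]:
    [y] and the parent of [x]. *)
Lemma adj_child x y : adj x y -> child x y \/ child y x.
Proof.
move=> a; have [dxy|dyx|e] := ltngtP (depth x) (depth y).
- by left; rewrite /child a.
- by right; rewrite /child adj_sym a.
have [xo|xo] := eqVneq x o.
  have yo : y = o by apply: depth_eq0; rewrite -e xo depth_root.
  by rewrite xo yo adj_irr in a.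
have [a' dp] := parentP xo.
have py : parent x = y.
  by apply: (@lower_neighbor_unique x _ _ _ a); [rewrite adj_sym | lia | lia].
by rewrite py in dp; lia.
Qed.

(** If [x] is deeper than [v], the truncated subtraction gives 0 and the test [v == x] correctly
    fails. *)
Definition ancestor (x v : V) : bool := iter (depth v - depth x) parent v == x.

Lemma depth_iter_parent k v : depth (iter k parent v) = (depth v - k)%N.
Proof. by elim: k => [|k IHk] /=; rewrite ?subn0// depth_parent IHk subnS. Qed.

Lemma ancestorP x v : reflect (exists k, iter k parent v = x) (ancestor x v).
Proof.
apply: (iffP eqP) => [<-|[k <-]]; first by exists (depth v - depth x)%N.
rewrite depth_iter_parent; have [kd|dk] := leqP k (depth v).
  by rewrite subKn.
apply/esym; rewrite -(subnK (ltnW dk)) iterD.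
have e : iter (depth v) parent v = o.
  by apply: depth_eq0; rewrite depth_iter_parent subnn.
have -> : (depth v - (k - depth v + depth v) = 0)%N by lia.
by rewrite subn0 e; elim: (_ - _)%N => //= n ->; rewrite parent_root.
Qed.

Lemma ancestor_refl v : ancestor v v.
Proof. by apply/ancestorP; exists 0%N. Qed.

Lemma ancestor_trans x y v : ancestor x y -> ancestor y v -> ancestor x v.
Proof.
move=> /ancestorP[k <-] /ancestorP[j <-]; apply/ancestorP.
by exists (k + j)%N; rewrite iterD.
Qed.

Lemma ancestor_depth x v : ancestor x v -> (depth x <= depth v)%N.
Proof. by move=> /ancestorP[k <-]; rewrite depth_iter_parent leq_subr. Qed.

Lemma ancestor_depth_eq x v : ancestor x v -> depth x = depth v -> x = v.
Proof. by move=> /eqP + e; rewrite e subnn. Qed.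

Lemma ancestor_root v : ancestor v o -> v = o.
Proof. by move=> /ancestor_depth; rewrite depth_root leqn0 => /eqP/depth_eq0. Qed.

Lemma root_ancestor v : ancestor o v.
Proof.
apply/ancestorP; exists (depth v); apply: depth_eq0.
by rewrite depth_iter_parent subnn.
Qed.

Lemma ancestor_comparable x y v : ancestor x v -> ancestor y v ->
  (depth x <= depth y)%N -> ancestor x y.
Proof.
move=> ax ay xy; apply/ancestorP; exists (depth y - depth x)%N.
have dy := ancestor_depth ay; move/eqP: ax => ax; move/eqP: ay => ay.
rewrite -{2}ay -iterD -[RHS]ax; have -> // : (depth y - depth x + (depth v - depth y) =
  depth v - depth x)%N by lia.
Qed.

Lemma ancestor_child x y : child x y -> ancestor x y.
Proof. by rewrite childE => /andP[_ /eqP <-]; apply/ancestorP; exists 1%N. Qed.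

Lemma ancestor_childE a x y : child x y -> ancestor a y = (a == y) || ancestor a x.
Proof.
move=> xy; apply/idP/orP => [ay|[/eqP ->|ax]]; last 2 first.
- exact: ancestor_refl.
- exact: ancestor_trans ax (ancestor_child xy).
have [da|da] := leqP (depth a) (depth x).
  by right; apply: ancestor_comparable ay (ancestor_child xy) da.
left; apply/eqP; apply: (ancestor_depth_eq ay).
have := ancestor_depth ay; have := depth_child xy; lia.
Qed.

(** A subtree can be entered only through its top vertex, so a walk from the root meets all
    ancestors of its end. *)
Lemma ancestor_adj a x y : adj x y -> ancestor a y -> a = y \/ ancestor a x.
Proof.
move=> /adj_child[xy|yx]; first by rewrite (ancestor_childE _ xy) => /predU1P.
by move=> ay; right; apply: ancestor_trans ay (ancestor_child yx).
Qed.

Lemma child_toward x v : ancestor x v -> x != v ->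
  exists2 y, child x y & ancestor y v.
Proof.
move=> xv xNv; have dx : (depth x < depth v)%N.
  rewrite ltn_neqAle ancestor_depth// andbT.
  by apply: contra xNv => /eqP /(ancestor_depth_eq xv) ->.
exists (iter (depth v - depth x).-1 parent v); last by apply/ancestorP; eexists.
rewrite childE -iterS prednK ?subn_gt0//; apply/andP; split; last exact: xv.
by apply/eqP => /(congr1 depth); rewrite depth_iter_parent depth_root; lia.
Qed.

Lemma child_toward_unique x y z v : child x y -> child x z ->
  ancestor y v -> ancestor z v -> y = z.
Proof.
move=> /depth_child dy /depth_child dz yv zv.
by apply: ancestor_depth_eq; [apply: ancestor_comparable yv zv _|]; rewrite dy dz.
Qed.

Lemma walk_ancestor p a : path adj o p -> ancestor a (last o p) -> a \in o :: p.
Proof.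
elim/last_ind: p => [_ /ancestor_root ->|p x IHp]; first exact: mem_head.
rewrite rcons_path last_rcons => /andP[pp ax] aa.
rewrite -rcons_cons mem_rcons inE.
by case: (ancestor_adj ax aa) => [->|/(IHp pp) ->]; rewrite ?eqxx ?orbT.
Qed.

(** The geodesic has [depth y] edges and depth grows by at most one along an edge, so every step
    leads to a child. *)
Lemma geodesic_ancestor y p x : geodesic adj o y p -> x \in o :: p -> ancestor x y.
Proof.
move=> [pp lp minp]; have : size p = depth y.
  have [p' [pp' lp' minp'] ->] := gdistP o y.
  by apply/eqP; rewrite eqn_leq minp//= minp'.
move: lp pp {minp}; elim/last_ind: p y => [|p z IHp] y.
  by rewrite /= inE => <- _ _ /eqP ->; exact: ancestor_refl.
rewrite last_rcons rcons_path size_rcons => -> {z} /andP[pp lpy] sp.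
have dl : (depth (last o p) <= size p)%N := gdist_le pp.
have c : child (last o p) y by rewrite /child lpy; lia.
rewrite -rcons_cons mem_rcons inE => /predU1P[->|xp]; first exact: ancestor_refl.
apply: ancestor_trans (ancestor_child c); apply: IHp => //.
by have := depth_child c; lia.
Qed.

Lemma ancestor_geodesic x y : ancestor x y -> exists2 p, geodesic adj o y p & x \in o :: p.
Proof.
move=> xy; have [p gp] := geodesic_ex o y; exists p => //.
by case: gp => pp lp _; apply: walk_ancestor => //; rewrite lp.
Qed.

(** Geodesics from the root pass exactly through ancestors, so the second clause says that [C] is an
    antichain of the ancestor order. *)
Lemma cutsetE (C : {fset V}) : cutset adj o C <->
  (forall gamma, infinite_path adj o gamma -> exists n, gamma n \in C) /\
  (forall x y, x \in C -> y \in C -> ancestor x y -> x = y).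
Proof.
split=> -[hit anti]; split=> // x y xC yC.
  move=> xy; apply: (ancestor_depth_eq xy).
  have := ancestor_depth xy; rewrite leq_eqVlt => /predU1P[//|dxy].
  by case: (anti _ _ xC yC dxy); exact: ancestor_geodesic.
move=> dxy [p gp xp]; have := anti _ _ xC yC (geodesic_ancestor gp xp).
by move=> e; rewrite e ltnn in dxy.
Qed.

Lemma root_componentE (C : {fset V}) v :
  root_component adj o C v <-> forall a, ancestor a v -> a \notin C.
Proof.
split=> [[p [pp lp hp]] a av|hv].
  by apply: hp; apply: walk_ancestor => //; rewrite lp.
have [p gp] := geodesic_ex o v; exists p; case: (gp) => pp lp _; split=> // x xp.
exact: hv (geodesic_ancestor gp xp).
Qed.

End RootedTree.

(** * Cutsets: backward induction, pruning and spheres *)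

Section Cutsets.
Variables (V : choiceType) (adj : rel V) (o : V).
Hypotheses (treeT : is_tree adj) (degT : bounded_degree adj).

Local Notation depth := (gdist adj o).
Local Notation child := (child adj o).
Local Notation ancestor := (ancestor adj o).
Local Notation cutset := (cutset adj o).
Local Notation inside := (inside adj o).

Let childrenS x : [set y | child x y] `<=` [set y | adj x y].
Proof. by move=> y /= /andP[]. Qed.

Lemma finite_children x : finite_set [set y | child x y].
Proof.
case: degT => D hD; apply: sub_finite_set (@childrenS x) _.
by apply/finite_set_leP; exists D; exact: hD.
Qed.

Definition children (x : V) : {fset V} := fset_set [set y | child x y].

Lemma mem_children x y : (y \in children x) = child x y.
Proof.
rewrite /children in_fset_set; last exact: finite_children.
by apply/idP/idP; rewrite inE.
Qed.

Lemma card_children : exists D : nat, forall x, (size (children x) <= D)%N.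
Proof.
case: degT => D hD; exists D => x; apply: geq_card_fset_set.
by apply: card_le_trans (hD x); apply: subset_card_le; exact: childrenS.
Qed.

(* Koenig's lemma: an infinite component would contain an infinite path. *)
Lemma finite_root_component (C : {fset V}) :
  (forall gamma, infinite_path adj o gamma -> exists n, gamma n \in C) ->
  finite_set (root_component adj o C).
Proof.
move=> hit; apply: contrapT => inf0.
pose below x := [set v | root_component adj o C v /\ ancestor x v].
have big0 : infinite_set (below o).
  move=> fin; apply: inf0; apply: sub_finite_set fin => v rv.
  by split=> //; exact: root_ancestor.
have step x : infinite_set (below x) -> exists y, child x y /\ infinite_set (below y).
  move=> infx; apply: contrapT => /forallNP h; apply: infx.
  apply: (@sub_finite_set _ _ ([set x] `|` \bigcup_(y in [set y | child x y]) below y)).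
    move=> v [rv xv]; have [->|/eqP xNv] := eqVneq x v; first by left.
    right; have [y xy yv] := child_toward treeT xv ltac:(exact/eqP).
    by exists y.
  rewrite finite_setU; split; first exact: finite_set1.
  apply: bigcup_finite; first exact: finite_children.
  by move=> y /= xy; apply: contrapT => infy; case: (h y).
pose next x := xget x [set y | child x y /\ infinite_set (below y)].
have nextP x : infinite_set (below x) -> child x (next x) /\ infinite_set (below (next x)).
  move=> /step ex; exact: (@xgetPex _ x [set y | child x y /\ infinite_set (below y)] ex).
pose gamma n := iter n next o.
have gbig n : infinite_set (below (gamma n)).
  by elim: n => [//|n IHn]; have [] := nextP _ IHn.
have gchild n : child (gamma n) (gamma n.+1) by have [] := nextP _ (gbig n).
have gdepth n : depth (gamma n) = n.
  elim: n => [|n IHn]; first exact: depth_root.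
  by rewrite (depth_child treeT (gchild n)) IHn.
have [] := hit gamma; last first.
  move=> n gC; have [v [/root_componentE h gv]] := infinite_setN0 (gbig n).
  by have := h treeT _ gv; rewrite gC.
split=> // [m n e|n]; first by rewrite -(gdepth m) -(gdepth n) e.
by have /andP[] := gchild n.
Qed.

Lemma insideP (C : {fset V}) v : cutset C ->
  reflect (forall a, ancestor a v -> a \notin C) (v \in inside C).
Proof.
move=> [hit _]; rewrite in_fset_set; last exact: finite_root_component.
by apply: (iffP idP); rewrite inE => /(root_componentE _ treeT).
Qed.

Lemma insideN (C : {fset V}) v : cutset C -> v \in inside C -> v \notin C.
Proof. by move=> cC /(insideP _ cC); apply; exact: ancestor_refl. Qed.

Lemma root_inside (C : {fset V}) : cutset C -> o \notin C -> o \in inside C.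
Proof. by move=> cC oC; apply/insideP => // a /(ancestor_root treeT) ->. Qed.

Lemma child_inside (C : {fset V}) x y : cutset C -> x \in inside C -> child x y ->
  (y \in C) || (y \in inside C).
Proof.
move=> cC xin xy; have [//|yC] := boolP (y \in C); apply/insideP => // a.
rewrite (ancestor_childE treeT _ xy) => /predU1P[->//|].
by move/(insideP _ cC): xin; apply.
Qed.

Lemma ancestor_inside (C : {fset V}) x y : cutset C -> ancestor x y ->
  y \in inside C -> x \in inside C.
Proof.
move=> cC xy /(insideP _ cC) yin; apply/insideP => // a ax; apply: yin.
exact: (ancestor_trans treeT ax xy).
Qed.

Lemma inside_depth_bound (C : {fset V}) :
  exists N, forall x, x \in inside C -> (depth x < N)%N.
Proof.
exists (\max_(x <- inside C) depth x).+1 => x xin.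
by rewrite ltnS (@leq_bigmax_seq _ _ _ (fun x => depth x)).
Qed.

(** Induction from the cutset back to the root. It is well founded because depths are bounded on the
    finite set [inside C]. *)
Lemma cutset_ind (C : {fset V}) (P : V -> Prop) : cutset C ->
  (forall x, x \in C -> P x) ->
  (forall x, x \in inside C -> (forall y, child x y -> P y) -> P x) ->
  P o /\ forall x, x \in inside C -> P x.
Proof.
move=> cC PC Pin; have [N hN] := inside_depth_bound C.
have Pins x : x \in inside C -> P x.
  have [n] := ubnP (N - depth x)%N; elim: n x => // n IHn x nx xin.
  apply: Pin => // y xy; have [/PC//|yin] := orP (child_inside cC xin xy).
  apply: IHn => //; have := depth_child treeT xy; have := hN _ yin; lia.
split=> //; have [/PC//|oC] := boolP (o \in C).
by apply: Pins; exact: root_inside.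
Qed.

Lemma cutset_antichain (C : {fset V}) x y : cutset C -> x \in C -> y \in C ->
  ancestor x y -> x = y.
Proof. by move=> /(cutsetE _ treeT)[_]; apply. Qed.

Lemma path_ancestor gamma n a : infinite_path adj o gamma -> ancestor a (gamma n) ->
  exists m, gamma m = a.
Proof.
move=> [g0 _ gadj]; elim: n => [|n IHn].
  by rewrite g0 => /(ancestor_root treeT) ->; exists 0%N.
by move=> /(ancestor_adj treeT (gadj n))[->|//]; exists n.+1.
Qed.

Definition prune (C : {fset V}) (x : V) : {fset V} :=
  (x |` [fset v in C | ~~ ancestor x v])%fset.

Lemma mem_prune C x v : (v \in prune C x) = (v == x) || ((v \in C) && ~~ ancestor x v).
Proof. by rewrite !inE. Qed.

(** A path that reaches [C] below [x] has passed through [x]; and the antichain property survives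
    because an inner [x] has no ancestor in [C]. *)
Lemma cutset_prune C x : cutset C -> x \in inside C -> cutset (prune C x).
Proof.
move=> cC xin; apply/(cutsetE _ treeT); split=> [gamma gP|y z].
  case: (cC) => /(_ _ gP)[n gC] _.
  have [xg|xg] := boolP (ancestor x (gamma n)); last first.
    by exists n; rewrite mem_prune gC xg orbT.
  have [m <-] := path_ancestor gP xg; exists m.
  by rewrite mem_prune eqxx.
rewrite !mem_prune => /predU1P[->|/andP[yC xy]] /predU1P[->|/andP[zC xz]] //.
- by rewrite (negbTE xz).
- by move=> /(insideP _ cC xin); rewrite yC.
- exact: (cutset_antichain cC yC zC).
Qed.

Lemma inside_prune C x : cutset C -> x \in inside C ->
  (inside (prune C x) `<` inside C)%fset.
Proof.
move=> cC xin; have cP := cutset_prune cC xin.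
rewrite fproperE; apply/andP; split.
  apply/fsubsetP => v /(insideP _ cP) h.
  apply/insideP => // a av; apply/negP => aC.
  have := h _ av; rewrite mem_prune aC negb_or /= negbK => /andP[_ xa].
  have := h _ (ancestor_trans treeT xa av).
  by rewrite mem_prune eqxx.
apply/negP => /fsubsetP /(_ _ xin) /(insideN cP).
by rewrite mem_prune eqxx.
Qed.

(** Pruning strictly shrinks the inside, so it terminates. The failure of [P] after one more pruning
    is the information exploited at each inner vertex. *)
Lemma minimal_cutset (C : {fset V}) (P : {fset V} -> Prop) : cutset C -> P C ->
  exists C', [/\ cutset C', P C' &
    forall x, x \in inside C' -> ~ P (prune C' x)].
Proof.
have [n] := ubnP (size (inside C)); elim: n C => // n IHn C Cn cC PC.
have [h|] := pselect (forall x, x \in inside C -> ~ P (prune C x)); first by exists C.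
move=> /existsNP[x /not_implyP[xin /contrapT Px]].
apply: (IHn (prune C x)) => //; last exact: cutset_prune.
by apply: leq_trans (fproper_ltn_card (inside_prune cC xin)) _.
Qed.

(** An inner [x] is not in [C], so every vertex of [C] below [x] lies below exactly one child of
    [x]. *)
Lemma sum_children (R : realType) (C : {fset V}) x (F : V -> R) :
  cutset C -> x \in inside C ->
  \sum_(y <- children x) \sum_(v <- C | ancestor y v) F v =
  \sum_(v <- C | ancestor x v) F v.
Proof.
move=> cC xin.
under eq_bigr do rewrite big_mkcond.
rewrite exchange_big /= [RHS]big_mkcond /=; apply: eq_big_seq => v vC.
have xNv : x != v by apply: contraNneq (insideN cC xin) => ->.
case: ifPn => xv; last first.
  rewrite big_seq big1// => y; rewrite mem_children => xy.
  rewrite ifN//; apply: contra xv; apply: (ancestor_trans treeT).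
  exact: (ancestor_child treeT xy).
have [y0 xy0 y0v] := child_toward treeT xv xNv.
rewrite (bigD1_seq y0) ?mem_children ?fset_uniq//= y0v big_seq_cond big1 ?addr0// => y.
rewrite mem_children => /andP[xy yy0]; rewrite ifN//.
by apply: contra yy0 => yv; apply/eqP; exact: (child_toward_unique treeT xy xy0 yv y0v).
Qed.

Lemma root_cutset : cutset [fset o]%fset.
Proof.
apply/(cutsetE _ treeT); split=> [gamma [g0 _ _]|x y].
  by exists 0%N; rewrite g0 inE.
by rewrite !inE => /eqP -> /eqP ->.
Qed.

Lemma infinite_path_depth gamma n : infinite_path adj o gamma -> depth (gamma n) = n.
Proof.
move=> [g0 ginj gadj].
(* Two consecutive depths are carried along: a step back to the parent would revisit the previous
   vertex, against injectivity. *)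
suff : depth (gamma n) = n /\ depth (gamma n.+1) = n.+1 by case.
elim: n => [|n [IH1 IH2]].
  have [c|c] := adj_child o treeT (gadj 0%N).
    by rewrite (depth_child treeT c) g0 (depth_root o treeT).
  by have := depth_child treeT c; rewrite g0 (depth_root o treeT).
split=> //; have [c|c] := adj_child o treeT (gadj n.+1).
  by rewrite (depth_child treeT c) IH2.
have c' : child (gamma n) (gamma n.+1).
  by rewrite /child gadj IH1 IH2 /=.
move: c c'; rewrite !(childE _ treeT) => /andP[_ /eqP e1] /andP[_ /eqP e2].
by have := ginj _ _ (etrans (esym e1) e2); lia.
Qed.

Fixpoint level (n : nat) : seq V :=
  if n is n'.+1 then flatten [seq (children x : seq V) | x <- level n'] else [:: o].

Lemma mem_level n v : (v \in level n) = (depth v == n).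
Proof.
elim: n v => [|n IHn] v /=.
  rewrite inE; apply/eqP/eqP => [->|]; first exact: depth_root.
  exact: depth_eq0.
apply/flatten_mapP/eqP => [[x]|dv].
  by rewrite IHn mem_children => /eqP <- /(depth_child treeT).
have vo : v != o by apply: contra_eq_neq dv => ->; rewrite (depth_root o treeT).
have [a d] := parentP treeT vo; exists (parent adj o v).
  by rewrite IHn -eqSS d dv.
by rewrite mem_children (childE _ treeT) vo eqxx.
Qed.

Definition sphere (n : nat) : {fset V} := [fset v in level n]%fset.

Lemma mem_sphere n v : (v \in sphere n) = (depth v == n).
Proof. by rewrite !inE mem_level. Qed.

Lemma sphere_cutset n : cutset (sphere n).
Proof.
apply/(cutsetE _ treeT); split=> [gamma gP|x y].
  by exists n; rewrite mem_sphere infinite_path_depth.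
rewrite !mem_sphere => /eqP dx /eqP dy xy.
by apply: (ancestor_depth_eq xy); rewrite dx dy.
Qed.

Lemma size_sphere D n : (forall x, (size (children x) <= D)%N) ->
  (size (sphere n) <= D ^ n)%N.
Proof.
move=> hD; apply: (@leq_trans (size (level n))).
  by apply: uniq_leq_size => // v; rewrite !inE.
elim: n => [|n IHn] //=; rewrite size_flatten /shape -map_comp sumnE big_map.
apply: (@leq_trans (\sum_(x <- level n) D)); first by apply: leq_sum => x _; exact: hD.
by rewrite big_const_seq count_predT iter_addn_0 expnS leq_mul2l IHn orbT.
Qed.

(** For [lambda] above the maximal number [D] of children, the sum over the sphere of radius [n] is
    at most [(D / lambda) ^ n], which tends to 0. This makes the [sup] in [branching_number] an
    actual upper bound of its set. *)
Lemma branching_set_bounded (R : realType) : exists D : R, forall lambda : R,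
  0 < lambda ->
  0 < inf [set \sum_(v <- C) lambda ^- depth v | C in cutset] -> lambda <= D.
Proof.
have [D hD] := card_children; exists D%:R => lambda l0 i0.
rewrite leNgt; apply/negP => Dl.
have [n hn] : exists n, (D%:R / lambda) ^+ n < inf [set \sum_(v <- C) lambda ^- depth v | C in cutset].
  have z1 : `|D%:R / lambda : R| < 1.
    by rewrite ger0_norm ?divr_ge0// ?(ltW l0)// ltr_pdivrMr// mul1r.
  have /cvgr0Pnorm_lt /(_ _ i0)[n _ /(_ n (leqnn n))] := cvg_expr z1.
  by exists n; apply: le_lt_trans (ler_norm _) _.
move: hn; rewrite ltNge => /negP; apply.
have lb : has_lbound [set \sum_(v <- C) lambda ^- depth v | C in cutset].
  exists 0 => _ [C _ <-]; apply: sumr_ge0 => v _.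
  by rewrite invr_ge0 exprn_ge0// ltW.
apply: le_trans (ge_inf lb _) _; first by exists (sphere n); [exact: sphere_cutset|reflexivity].
rewrite (eq_big_seq (fun=> lambda ^- n)); last first.
  by move=> v; rewrite mem_sphere => /eqP ->.
rewrite big_const_seq count_predT iter_addr_0 -[leLHS]mulr_natl expr_div_n.
rewrite ler_wpM2r ?invr_ge0 ?exprn_ge0// ?(ltW l0)// -natrX ler_nat.
exact: size_sphere.
Qed.

End Cutsets.

(** * Messages *)

Section TreeSum.
Variables (R : comNzRingType) (I T : finType) (r : I) (par : I -> I) (d : I -> nat).
Hypothesis d_par : forall y, y != r -> (d (par y) < d y)%N.
Variables (K : T -> T -> R) (t0 : T).

(** Configurations on [A] are encoded as total functions frozen at [t0] off [A], so that their type
    does not change while vertices are summed out. *)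
Let supported (A : {set I}) (w : {ffun I -> T}) := [forall x, (x \notin A) ==> (w x == t0)].
Let upd z (w : {ffun I -> T}) t : {ffun I -> T} := [ffun x => if x == z then t else w x].

Let sum_upd (A : {set I}) z (F : {ffun I -> T} -> R) k : z \in A -> z != r ->
  \sum_(w : {ffun I -> T} | (w r == k) && supported A w) F w =
  \sum_(w : {ffun I -> T} | (w r == k) && supported (A :\ z) w) \sum_t F (upd z w t).
Proof.
move=> zA zr.
rewrite (partition_big (fun w => upd z w t0)
  (fun w => (w r == k) && supported (A :\ z) w)) /=; last first.
  move=> w /andP[wr /forallP sA]; rewrite ffunE (eq_sym r) (negbTE zr) wr /=.
  apply/forallP => x; apply/implyP; rewrite in_setD1 negb_and negbK ffunE.
  by case: eqP => //= _ xA; have := sA x; rewrite xA.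
apply: eq_bigr => w /andP[wr /forallP sA].
have wz : w z = t0 by have := sA z; rewrite in_setD1 eqxx /= => /eqP.
rewrite (reindex_onto (upd z w) (fun w => w z)) /=.
  apply: eq_bigl => t; rewrite !ffunE eqxx eqxx andbT (eq_sym r) (negbTE zr) wr /=.
  apply/andP; split.
    apply/forallP => x; apply/implyP => xA; rewrite ffunE ifN.
      by have := sA x; rewrite in_setD1 (negbTE xA) andbF.
    by apply: contraNneq xA => ->.
  by apply/eqP/ffunP => x; rewrite !ffunE; case: eqP => // ->.
move=> w' /andP[_ /eqP e]; apply/ffunP => x; rewrite ffunE; case: eqP => [->//|/eqP xz].
by rewrite -e ffunE (negbTE xz).
Qed.

(* Summing out a vertex of maximal depth multiplies the weight of its parent;
   the messages [h] are unaffected. *)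
Let sum_peel n (A : {set I}) (phi h : I -> T -> R) :
  #|A| = n.+1 -> r \in A ->
  (forall y, y \in A -> y != r -> par y \in A) ->
  (forall x k, x \in A -> h x k = phi x k *
     \prod_(y in A | (y != r) && (par y == x)) \sum_l K k l * h y l) ->
  forall k, \sum_(w : {ffun I -> T} | (w r == k) && supported A w)
    ((\prod_(x in A) phi x (w x)) *
     \prod_(y in A | y != r) K (w (par y)) (w y)) = h r k.
Proof.
elim: n A phi => [|n IHn] A phi cA rA parA hE k.
  have {}cA : A = [set r]%SET.
    by move/eqP/cards1P : cA rA => [x ->]; rewrite inE => /eqP ->.
  rewrite {}cA in rA parA hE *.
  have none x : (x \in [set r]%SET) && (x != r) = false by rewrite inE andbN.
  rewrite hE// [in RHS]big_pred0 => [|y]; last by rewrite andbA none.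
  rewrite (big_pred1 [ffun x => if x == r then k else t0]).
    by rewrite big_set1 ffunE eqxx big_pred0.
  move=> w; apply/andP/eqP => [[/eqP wr /forallP s]|->].
    apply/ffunP => x; rewrite ffunE; case: eqP => [->//|/eqP xr].
    by have := s x; rewrite inE xr => /eqP.
  rewrite ffunE eqxx; split=> //; apply/forallP => x; apply/implyP; rewrite inE ffunE.
  by move=> /negbTE ->.
have [z0 z0A] : exists z, z \in A :\ r.
  by apply/set0Pn; rewrite -card_gt0; have := cardsD1 r A; rewrite rA cA => cAr; lia.
have [z zA zmax] := @arg_maxnP _ z0 [pred z | z \in A :\ r] d z0A.
move: zA => /=; rewrite in_setD1 => /andP[zr zA].
have par_neq y : y \in A -> y != r -> par y != z.
  move=> yA yr; apply: contraTneq (d_par yr) => ->; rewrite -leqNgt.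
  by apply: zmax; rewrite /= in_setD1 yr.
have rA' : r \in A :\ z by rewrite in_setD1 eq_sym zr.
have hz l : h z l = phi z l.
  rewrite hE// big_pred0 ?mulr1// => y; apply/negP => /and3P[yA yr].
  by apply/negP; exact: par_neq.
rewrite (sum_upd _ _ zA zr).
pose phi' x k := phi x k * (if x == par z then \sum_l K k l * h z l else 1).
rewrite -(IHn (A :\ z) phi') //; first last.
- move=> x j; rewrite in_setD1 => /andP[xz xA]; rewrite hE// /phi' -mulrA; congr (_ * _).
  have eA (P : pred I) : (fun y => [&& y \in A, y != r & P y] && (y != z)) =1
      (fun y => [&& y \in A :\ z, y != r & P y]).
    by move=> y; rewrite in_setD1; case: (y == z); case: (y \in A); rewrite /= ?andbF ?andbT.
  have [xp|xp] := eqVneq x (par z).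
    rewrite (bigD1 z) /=; last by rewrite zA zr xp eqxx.
    by congr (_ * _); apply: eq_bigl => y; exact: (eA (fun y => par y == x)).
  rewrite mul1r; apply: eq_bigl => y; rewrite -(eA (fun y => par y == x)).
  have [->|_] := eqVneq y z; last by rewrite andbT.
  by rewrite (eq_sym (par z)) (negbTE xp) !andbF.
- move=> y; rewrite !in_setD1 => /andP[yz yA] yr.
  by rewrite par_neq//= parA.
- by have := cardsD1 z A; rewrite zA cA => -[].
apply: eq_bigr => w _.
have pzA : par z \in A :\ z by rewrite in_setD1 par_neq//= parA.
have -> : \prod_(x in A :\ z) phi' x (w x) =
    (\sum_l K (w (par z)) l * h z l) * \prod_(x in A :\ z) phi x (w x).
  rewrite /phi' big_split /= mulrC; congr (_ * _).
  rewrite (bigD1 (par z))//= eqxx [X in _ * X]big1 ?mulr1// => x /andP[_ xp].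
  by rewrite (negbTE xp).
rewrite !mulr_suml; apply: eq_bigr => t _.
rewrite (big_setD1 z zA) /= ffunE eqxx [X in _ * X = _](bigD1 z) /=; last by rewrite zA.
rewrite !ffunE eqxx (negbTE (par_neq z zA zr)) hz.
have -> : \prod_(x in A :\ z) phi x (upd z w t x) = \prod_(x in A :\ z) phi x (w x).
  by apply: eq_bigr => x; rewrite in_setD1 ffunE => /andP[/negbTE ->].
have -> : \prod_(y | (y \in A) && (y != r) && (y != z))
    K (upd z w t (par y)) (upd z w t y) =
    \prod_(y in A :\ z | y != r) K (w (par y)) (w y).
  apply: eq_big => [y|y /andP[/andP[yA yr] yz]].
    by rewrite in_setD1; case: (y == z); case: (y \in A); rewrite /= ?andbF ?andbT.
  by rewrite !ffunE (negbTE yz) (negbTE (par_neq y yA yr)).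
by rewrite [phi z t * _]mulrC; ring.
Qed.

Lemma tree_sum (phi h : I -> T -> R) :
  (forall x k, h x k = phi x k *
     \prod_(y | (y != r) && (par y == x)) \sum_l K k l * h y l) ->
  forall k, \sum_(w : {ffun I -> T} | w r == k)
    \prod_x (phi x (w x) * \prod_(y | (y != r) && (par y == x)) K (w x) (w y)) =
  h r k.
Proof.
move=> hE k.
have [n cn] : exists n, #|[set: I]%SET| = n.+1.
  by exists #|[set: I]%SET|.-1; rewrite prednK// card_gt0; apply/set0Pn; exists r.
rewrite -(sum_peel (phi := phi) cn) => //; first last.
- by move=> x j _; rewrite hE; congr (_ * _); apply: eq_bigl => y; rewrite inE.
apply: eq_big => [w|w _].
  by case: eqP => //= _; apply/esym/forallP => x; rewrite inE.
rewrite big_split /=; congr (_ * _).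
  by apply: eq_bigl => x; rewrite inE.
rewrite [RHS](partition_big par xpredT)//=; apply: eq_bigr => x _.
by apply: eq_big => [y|y /andP[_ /eqP ->]]; rewrite ?inE.
Qed.

End TreeSum.

(** * The message recursion and the marginal at the root *)

Section Messages.
Variables (R : realType) (V : choiceType) (adj : rel V) (o : V).
Hypotheses (treeT : is_tree adj) (degT : bounded_degree adj).
Variables (q : nat) (M : 'M[R]_((Zp_trunc q).+2)).
Hypotheses (q_gt1 : (1 < q)%N) (clockM : clock_transfer_matrix M).
Variables (u : R) (C : {fset V}).
Hypotheses (u_gt0 : 0 < u) (cutC : cutset adj o C).
Local Notation T := 'Z_q.
Local Notation depth := (gdist adj o).
Local Notation children := (children adj o).
Local Notation inside := (inside adj o C).

Definition message_product (H : V -> T -> R) (x : V) (k : T) : R :=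
  \prod_(y <- children x) H y k.

(** Monotonicity and positivity are required at every vertex, even beyond the cutset, so that
    statements on whole families such as [magn_prod] apply to [H] as it is. *)
Record is_message (H : V -> T -> R) : Prop := IsMessage {
  message_mono : forall x, cos_mono (H x);
  message_gt0 : forall x k, 0 < H x k;
  message_boundary : forall x, x \in C -> H x = boundary_message M u;
  message_inside : forall x, x \in inside -> H x = transfer M (message_product H x)
}.

(** Started with fuel [N - depth x], where [N] exceeds all inner depths, the recursion does not run
    out at inner vertices. The default value is again cosine-monotone and positive. *)
Fixpoint message_rec (n : nat) (x : V) : T -> R :=
  if n is n'.+1 then
    if x \in C then boundary_message M u
    else transfer M (fun k => \prod_(y <- children x) message_rec n' y k)
  else boundary_message M u.

Lemma message_rec_gt0 n x k : 0 < message_rec n x k.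
Proof.
elim: n x k => [|n IHn] x k /=; first exact: boundary_message_gt0.
case: ifP => _; first exact: boundary_message_gt0.
by apply: transfer_gt0 => // l; apply: prodr_gt0 => y _; exact: IHn.
Qed.

Lemma message_rec_mono n x : cos_mono (message_rec n x).
Proof.
have Bm := cos_mono_boundary_message q_gt1 clockM (ltW u_gt0).
elim: n x => [|n IHn] x //=; case: ifP => _ //.
apply: cos_mono_transfer => //; apply: cos_mono_prod => // y k.
exact: message_rec_gt0.
Qed.

Lemma message_ex : exists H, is_message H.
Proof.
have [N hN] := inside_depth_bound adj o C.
exists (fun x => message_rec (N - depth x) x); split => [x|x k|x xC|x xin].
- exact: message_rec_mono.
- exact: message_rec_gt0.
- by case: (N - depth x)%N => //= n; rewrite xC.
have := hN _ xin; rewrite -subn_gt0; case e: (N - depth x)%N => [//|n] _ /=.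
rewrite (negbTE (insideN treeT degT cutC xin)); congr transfer; apply/funext => k.
apply: eq_big_seq => y; rewrite mem_children// => /(depth_child treeT) dy.
by congr message_rec; lia.
Qed.

Lemma message_product_gt0 H x k : is_message H -> 0 < message_product H x k.
Proof. by move=> HM; apply: prodr_gt0 => y _; exact: message_gt0. Qed.

Lemma message_product_mono H x : is_message H -> cos_mono (message_product H x).
Proof.
by move=> HM; apply: cos_mono_prod => y; [exact: message_mono|exact: message_gt0].
Qed.

Lemma magn_message_inside H x : is_message H -> x \in inside ->
  magn (H x) = cos_eigenvalue M * magn (message_product H x).
Proof. by move=> HM xin; rewrite (message_inside HM)// magn_transfer. Qed.

Hypothesis oC : o \notin C.

Let oin : o \in inside. Proof. exact: root_inside. Qed.
Let r : inside := [` oin]%fset.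
Let par (x : inside) : inside := insubd r (parent adj o (val x)).

Let par_child (x y : inside) :
  (y != r) && (par y == x) = child adj o (val x) (val y).
Proof.
rewrite childE// -(inj_eq val_inj) /=; case: eqP => //= yo.
rewrite -(inj_eq val_inj) /par val_insubd.
rewrite (ancestor_inside treeT degT cutC _ (valP y))//.
by apply/ancestorP => //; exists 1%N.
Qed.

(** The Boltzmann weight in the shape of [tree_sum]: edges into [C] form the vertex weights, inner
    edges carry the kernel [M]. *)
Let weight (w : {ffun inside -> T}) : expR (- energy M u w) =
  \prod_x (\prod_(y <- C | adj (val x) y) boundary_message M u (w x) *
    \prod_(y | (y != r) && (par y == x)) M (w x) (w y)).
Proof.
rewrite /energy opprD expRD big_split /= mulrC; congr (_ * _).
  rewrite mulr_sumr -sumrN expR_sum; apply: eq_bigr => x _.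
  by rewrite mulr_sumr -sumrN expR_sum.
rewrite -sumrN expR_sum; apply: eq_bigr => x _.
rewrite -sumrN expR_sum; apply: eq_big => [y|y _]; first by rewrite par_child.
by rewrite /potential opprK lnK// posrE (ctm_gt0 clockM).
Qed.

(** The children of an inner vertex are in [C] or inner. Conversely a neighbor in [C] must be a
    child, because ancestors of inner vertices avoid [C]. *)
Let messageE H (HM : is_message H) (x : inside) k :
  message_product H (val x) k =
  \prod_(y <- C | adj (val x) y) boundary_message M u k *
    \prod_(y | (y != r) && (par y == x))
       \sum_l M k l * message_product H (val y) l.
Proof.
rewrite /message_product (bigID (fun y => y \in C)) /=; congr (_ * _).
  rewrite -big_filter -[RHS]big_filter.
  transitivity (\prod_(y <- [seq y <- children (val x) | y \in C]) boundary_message M u k).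
    apply: eq_big_seq => y; rewrite mem_filter => /andP[yC _].
    by rewrite (message_boundary HM).
  apply: perm_big; apply: uniq_perm; rewrite ?filter_uniq ?fset_uniq// => y.
  rewrite !mem_filter mem_children// andbC.
  have [yC|] := boolP (y \in C); last by rewrite !andbF.
  rewrite !andbT; apply/idP/idP => [/andP[//]|/(adj_child o treeT)[//|yx]].
  have /(insideP treeT degT _ cutC) := valP x.
  by move=> /(_ _ (ancestor_child treeT yx)); rewrite yC.
under [RHS]eq_bigl do rewrite par_child.
transitivity (\prod_(y : inside | child adj o (val x) (val y)) H (val y) k).
  rewrite -(@big_seq_fsetE _ _ _ _ _ (fun y => child adj o (val x) y) (fun y => H y k)).
  rewrite -big_filter -[RHS]big_filter; apply: perm_big.
  apply: uniq_perm; rewrite ?filter_uniq ?fset_uniq// => y.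
  rewrite !mem_filter mem_children// andbC; case xy: (child _ _ _ _) => //=.
  apply/idP/idP => [yC|/(insideN treeT degT cutC)//].
  by have := child_inside treeT degT cutC (valP x) xy; rewrite (negbTE yC).
by apply: eq_bigr => y _; rewrite (message_inside HM) ?(valP y).
Qed.

Let partial_partition_function H k : is_message H ->
  \sum_(w : {ffun inside -> T} | w r == k) expR (- energy M u w) =
  message_product H o k.
Proof.
move=> HM.
have d_par (y : inside) : y != r -> (depth (val (par y)) < depth (val y))%N.
  move=> yr; have : child adj o (val (par y)) (val y) by rewrite -par_child yr eqxx.
  by move=> /(depth_child treeT) ->.
rewrite -(tree_sum d_par (0 : T) (messageE HM) k).
by apply: eq_bigr => w _; rewrite weight.
Qed.

Lemma root_marginalE H k : is_message H ->
  root_marginal adj o M u C k =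
  (\sum_l message_product H o l)^-1 * message_product H o k.
Proof.
move=> HM; rewrite /root_marginal /gibbs -mulr_suml mulrC; congr (_^-1 * _).
  rewrite /partition_function (partition_big (fun w : {ffun inside -> T} => w r) xpredT)//=.
  by apply: eq_bigr => l _; rewrite -partial_partition_function.
rewrite -(partial_partition_function _ HM); apply: eq_bigl => w.
apply/existsP/eqP => [[x /andP[/eqP xo /eqP <-]]|<-]; last by exists r; rewrite /= !eqxx.
by congr (w _); exact: val_inj.
Qed.

End Messages.

(** * The two phases *)

Section RobustPhaseTransition.
Variables (R : realType) (V : choiceType) (adj : rel V) (o : V).
Hypotheses (treeT : is_tree adj) (degT : bounded_degree adj).
Variables (q : nat) (M : 'M[R]_((Zp_trunc q).+2)).
Hypotheses (q_gt1 : (1 < q)%N) (clockM : clock_transfer_matrix M).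
Local Notation T := 'Z_q.
Local Notation N := (#|{: T}|%:R : R).
Local Notation depth := (gdist adj o).
Local Notation child := (child adj o).
Local Notation ancestor := (ancestor adj o).
Local Notation cutset := (cutset adj o).
Local Notation inside := (inside adj o).
Local Notation children := (children adj o).
Local Notation message_product := (message_product adj o).
Local Notation L := (cos_eigenvalue M).

Lemma root_deviation_le (u : R) (C : {fset V}) H : 0 < u -> cutset C -> o \notin C ->
  is_message adj o M u C H ->
  root_deviation adj o M u C <= osc_const R q * magn (message_product H o).
Proof.
move=> u0 cC oC HM.
have h0 k := message_product_gt0 o k HM.
have S0 := sumZ_gt0 h0; set S := \sum__ _ in S0.
have hm := message_product_mono o HM.
apply: bigmax_le => [|k _].
  by rewrite mulr_ge0 ?(ltW (osc_const_gt0 _ _))// magn_ge0.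
rewrite (root_marginalE treeT degT clockM cC oC k HM) -/S.
have -> : q%:R = N by rewrite card_ord Zp_cast.
rewrite -(@magnZ _ _ S^-1) ?invr_neq0 ?gt_eqF//.
apply: (@deviation_le _ _ q_gt1 (fun k => S^-1 * message_product H o k)).
  by apply: cos_monoZ => //; rewrite invr_ge0 ltW.
by rewrite -mulr_sumr mulVf ?gt_eqF.
Qed.

(** As the cosines sum to zero, [magn] of the root marginal [p] is the sum of
    [cosZ k * (p k - q^-1)]. *)
Lemma root_deviation_ge (u : R) (C : {fset V}) H : 0 < u -> cutset C -> o \notin C ->
  is_message adj o M u C H ->
  magn (message_product H o) <= N * root_deviation adj o M u C.
Proof.
move=> u0 cC oC HM.
have h0 k := message_product_gt0 o k HM.
have S0 := sumZ_gt0 h0; set S := \sum__ _ in S0.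
rewrite -(@magnZ _ _ S^-1) ?invr_neq0 ?gt_eqF// /magn.
rewrite -[X in _ / X]mulr_sumr mulVf ?gt_eqF// divr1.
apply: (@le_trans _ _ (\sum_(k : T) root_deviation adj o M u C)); last first.
  by rewrite sumr_const mulr_natl.
have -> : \sum_k cosZ R k * (S^-1 * message_product H o k) =
    \sum_k cosZ R k * (S^-1 * message_product H o k - q%:R^-1).
  under [RHS]eq_bigr do rewrite mulrBr.
  by rewrite sumrB -[X in _ - X]mulr_suml sum_cosZ// mul0r subr0.
apply: ler_sum => k _; apply: le_trans (ler_norm _) _.
rewrite normrM -[leRHS]mul1r ler_pM// ?normr_cosZ_le1//.
rewrite -(root_marginalE treeT degT clockM cC oC k HM).
exact: (le_bigmax_cond _ (fun k => `|root_marginal adj o M u C k - q%:R^-1|)).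
Qed.

Lemma sum_prune (C : {fset V}) x (F : V -> R) :
  \sum_(v <- prune adj o C x) F v = F x + \sum_(v <- C | ~~ ancestor x v) F v.
Proof.
rewrite /prune big_fsetU1 /=; last first.
  by apply/negP; rewrite !inE => /andP[_]; rewrite ancestor_refl.
congr (_ + _); rewrite -[RHS]big_filter; apply: perm_big; apply: uniq_perm.
- exact: fset_uniq.
- by rewrite filter_uniq.
by move=> v; rewrite mem_filter !inE andbC.
Qed.

Lemma sum_cutset_below (C : {fset V}) x (F : V -> R) : cutset C -> x \in C ->
  \sum_(v <- C | ancestor x v) F v = F x.
Proof.
move=> cC xC; rewrite -big_filter; transitivity (\sum_(v <- [:: x]) F v); last by rewrite big_seq1.
apply: perm_big.
apply: uniq_perm; rewrite ?filter_uniq// => v; rewrite mem_filter inE.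
apply/andP/eqP => [[xv vC]|->]; last by rewrite ancestor_refl.
by rewrite (cutset_antichain treeT cC xC vC).
Qed.

Lemma sum_below_root (C : {fset V}) (F : V -> R) :
  \sum_(v <- C | ancestor o v) F v = \sum_(v <- C) F v.
Proof. by apply: eq_bigl => v; rewrite root_ancestor. Qed.

(** The strength [u] is fixed before [e]. For a minimal [C] of weight below [e1], backward induction
    gives [magn (H x) * lam ^+ depth x <= e0 * S x], so the deviation at the root is at most a
    constant times the weight of [C]. *)
Lemma no_robust_phase_transition (lam : R) : 0 <= L -> L < lam ->
  (forall e : R, 0 < e -> exists2 C, cutset C & \sum_(v <- C) lam ^+ depth v < e) ->
  exists u : R, [/\ 0 < u, u <= 1 & forall e : R, 0 < e ->
    exists C, [/\ cutset C, o \notin C & root_deviation adj o M u C < e]].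
Proof.
move=> L0 Llam small; have lam0 : 0 < lam := le_lt_trans L0 Llam.
pose d := lam - L; have d0 : 0 < d by rewrite subr_gt0.
have L1 := cos_eigenvalue_lt1 q_gt1 clockM.
have Ld : L * (1 + d) <= lam by rewrite mulrDr mulr1 -lerBrDl -/d ler_piMl ?ltW.
have [eta eta0 etaP] := magn_prod q_gt1 d0.
(* Chosen so that [A x * lam ^+ (depth x).+1 <= e0 * S x] and [S x <= lam ^+ depth x] together give
   [A x <= eta]. *)
pose e0 := eta * lam; have e00 : 0 < e0 by rewrite mulr_gt0.
have [u [u0 u1 uB]] := magn_boundary_message_small q_gt1 clockM e00.
exists u; split => // e epos.
pose K := osc_const R q * (1 + d) * e0 / lam.
have O0 := osc_const_gt0 R q.
have K0 : 0 < K by rewrite divr_gt0// mulr_gt0// mulr_gt0// addr_gt0.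
(* The bound 1 keeps the root out of [C], since [lam ^+ 0 = 1]; [e / K] yields the final
   estimate. *)
pose e1 := Num.min 1 (e / K).
have e10 : 0 < e1 by rewrite lt_min ltr01 divr_gt0.
have [C0 cC0 sC0] := small _ e10.
have [C [cC sC Cmin]] := minimal_cutset treeT degT
  (P := fun C : {fset V} => \sum_(v <- C) lam ^+ depth v < e1) cC0 sC0.
pose S x := \sum_(v <- C | ancestor x v) lam ^+ depth v.
have lamX n : 0 < lam ^+ n by rewrite exprn_gt0.
have SC x : x \in C -> S x = lam ^+ depth x by exact: sum_cutset_below.
(* Pruning at [x] replaces [S x] by [lam ^+ depth x] in the total weight, and by minimality the new
   total is no longer below [e1]. *)
have Sin x : x \in inside C -> S x <= lam ^+ depth x.
  move=> xin; have := Cmin _ xin; rewrite sum_prune => /negP; rewrite -leNgt => h.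
  have := sC; rewrite (bigID (fun v => ancestor x v)) /= -/(S x); lra.
have So : S o = \sum_(v <- C) lam ^+ depth v := sum_below_root _ _.
have oC : o \notin C.
  apply/negP => /SC; rewrite So depth_root// expr0 => e2.
  by move: sC; rewrite e2 lt_min ltxx.
have [H HM] := message_ex treeT degT q_gt1 clockM u0 cC.
have mH x : 0 <= magn (H x).
  by apply: magn_ge0 => //; [exact: (message_gt0 HM) | exact: (message_mono HM)].
pose A x := \sum_(y <- children x) magn (H y).
pose P x := magn (H x) * lam ^+ depth x <= e0 * S x.
have PA x : x \in inside C -> (forall y, child x y -> P y) ->
    A x * lam ^+ (depth x).+1 <= e0 * S x.
  move=> xin Py; rewrite /S -(sum_children treeT degT _ cC xin) mulr_suml mulr_sumr.
  rewrite big_seq [leRHS]big_seq; apply: ler_sum => y; rewrite mem_children// => xy.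
  by rewrite -(depth_child treeT xy); exact: Py.
have Aeta x : x \in inside C -> (forall y, child x y -> P y) -> A x <= eta.
  move=> xin Py; have h := PA x xin Py; have Sx := Sin x xin.
  rewrite -(ler_pM2r (lamX (depth x).+1)); apply: le_trans h _.
  by rewrite exprS mulrA -/e0 ler_wpM2l// ltW.
have hA x : x \in inside C -> (forall y, child x y -> P y) ->
    magn (message_product H x) <= (1 + d) * A x.
  move=> xin Py.
  have := etaP _ (children x) H (message_mono HM) (message_gt0 HM) (Aeta x xin Py).
  rewrite -/(A x) -/(message_product H x) ler_norml => /andP[_]; lra.
have [_ Pall] : P o /\ forall x, x \in inside C -> P x.
  apply: (cutset_ind treeT degT cC) => [x xC|x xin Py].
    by rewrite /P SC// ler_wpM2r ?(ltW (lamX _))// (message_boundary HM).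
  apply: le_trans (PA x xin Py); rewrite exprS mulrA ler_wpM2r ?(ltW (lamX _))//.
  rewrite (magn_message_inside q_gt1 clockM HM xin).
  apply: le_trans (ler_wpM2l L0 (hA x xin Py)) _.
  by rewrite mulrA mulrC ler_wpM2l// sumr_ge0.
have oin := root_inside treeT degT cC oC.
have Pchild y : child o y -> P y.
  move=> /(child_inside treeT degT cC oin)/orP[yC|]; last exact: Pall.
  by rewrite /P SC// ler_wpM2r ?(ltW (lamX _))// (message_boundary HM).
exists C; split=> //.
apply: le_lt_trans (root_deviation_le u0 cC oC HM) _.
have h1 := hA o oin Pchild; have := PA o oin Pchild.
rewrite depth_root// expr1 => h2.
apply: (@le_lt_trans _ _ (K * S o)).
  have -> : K * S o = osc_const R q * ((1 + d) * (e0 * S o / lam)).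
    by rewrite /K; field; rewrite gt_eqF.
  apply: ler_wpM2l; first exact: ltW.
  apply: le_trans h1 _; apply: ler_wpM2l; first by rewrite addr_ge0// ltW.
  by rewrite ler_pdivlMr.
rewrite So; move: sC; rewrite lt_min => /andP[_].
by rewrite ltr_pdivlMr// mulrC.
Qed.

(** The cutset [C] is pruned to a minimal [C'] on which messages have magnetization at least [beta].
    Inside [C'] it is below [beta], which forces the linear regime, and the induction carries the
    lower bound [c] on the weight of [C'] to the root. *)
Lemma robust_deviation_bound (lam c u : R) : 0 < lam -> lam < L -> 0 < c ->
  (forall C, cutset C -> c <= \sum_(v <- C) lam ^+ depth v) -> 0 < u ->
  exists2 b : R, 0 < b & forall C, cutset C -> o \notin C -> b <= root_deviation adj o M u C.
Proof.
move=> lam0 lamL c0 large u0; have L0 : 0 < L := lt_trans lam0 lamL.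
pose d := L - lam; have d0 : 0 < d by rewrite subr_gt0.
have L1 := cos_eigenvalue_lt1 q_gt1 clockM.
have Ld : lam <= L * (1 - d).
  by rewrite mulrBr mulr1 lerBrDr -lerBrDl -/d ler_piMl ?ltW.
have [eta eta0 etaP] := magn_prod q_gt1 d0.
have [D hD] := card_children o degT.
have D0 : 0 < D.+1%:R :> R by rewrite ltr0n.
(* The second bound makes [C] itself admissible. The first is exceeded or attained at [x] as soon as
   one child has magnetization at least [eta / D.+1], which must occur among at most [D] children
   when [A x > eta]. *)
pose beta := Num.min (L * (eta / D.+1%:R)) (magn (boundary_message M u)).
have beta0 : 0 < beta.
  rewrite lt_min; apply/andP; split; last exact: magn_boundary_message_gt0.
  by rewrite mulr_gt0// divr_gt0.
have N0 := @card_Zq_gt0 R q.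
exists (beta * c / N); first by rewrite divr_gt0// mulr_gt0.
move=> C cC oC.
have [H HM] := message_ex treeT degT q_gt1 clockM u0 cC.
have mH x : 0 <= magn (H x).
  by apply: magn_ge0 => //; [exact: (message_gt0 HM) | exact: (message_mono HM)].
pose A x := \sum_(y <- children x) magn (H y).
have A0 x : 0 <= A x by apply: sumr_ge0.
have step x : x \in inside C -> magn (H x) < beta -> lam * A x <= magn (H x).
  move=> xin; rewrite (magn_message_inside q_gt1 clockM HM xin).
  have [Aeta _|etaA] := leP (A x) eta.
    have := etaP _ (children x) H (message_mono HM) (message_gt0 HM) Aeta.
    rewrite -/(A x) -/(message_product H x) ler_norml => /andP[h _].
    apply: le_trans (ler_wpM2r (A0 x) Ld) _.
    by rewrite -mulrA ler_wpM2l ?(ltW L0)//; lra.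
  have [y yx ylarge] : exists2 y, y \in children x & eta / D.+1%:R <= magn (H y).
    apply: contrapT => h; move: etaA; rewrite ltNge => /negP; apply.
    apply: (@le_trans _ _ (\sum_(y <- children x) eta / D.+1%:R)).
      rewrite /A big_seq [leRHS]big_seq; apply: ler_sum => y yx.
      by rewrite leNgt; apply/negP => /ltW ylarge; apply: h; exists y.
    rewrite big_const_seq count_predT iter_addr_0 -[leLHS]mulr_natr mulrAC ler_pdivrMr//.
    by rewrite ler_wpM2l ?(ltW eta0)// ler_nat ltnW// ltnS.
  rewrite ltNge => /negP[]; rewrite ge_min; apply/orP; left.
  rewrite ler_wpM2l ?(ltW L0)//; apply: le_trans ylarge _.
  have -> : message_product H x =
      fun k => (\prod_(z <- children x | z != y) H z k) * H y k.
    apply/funext => k.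
    by rewrite /message_product (bigD1_seq y) ?fset_uniq//= mulrC.
  apply: magnM_ge => //; first by move=> k; exact: (message_gt0 HM).
    by move=> k; apply: prodr_gt0 => z _; exact: (message_gt0 HM).
  have -> : (fun k => \prod_(z <- children x | z != y) H z k) =
      (fun k => \prod_(z <- [seq z <- children x | z != y]) H z k).
    by apply/funext => k; rewrite big_filter.
  by apply: cos_mono_prod; [exact: (message_mono HM)|exact: (message_gt0 HM)].
(* Keeping the inside of [C'] within that of [C] ensures that the messages built from [C] still obey
   the recursion there. *)
pose Q (C' : {fset V}) := (inside C' `<=` inside C)%fset /\
  forall x, x \in C' -> beta <= magn (H x).
have QC : Q C.
  by split=> // x xC; rewrite (message_boundary HM)// ge_min lexx orbT.
have [C' [cC' [subC' betaC'] Cmin]] := minimal_cutset treeT degT cC QC.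
have betain x : x \in inside C' -> magn (H x) < beta.
  move=> xin; rewrite ltNge; apply/negP => bx; apply: (Cmin x xin); split.
    exact: fsubset_trans (fproper_sub (inside_prune treeT degT cC' xin)) subC'.
  by move=> y; rewrite mem_prune => /predU1P[->//|/andP[/betaC']].
pose S x := \sum_(v <- C' | ancestor x v) lam ^+ depth v.
have lamX n : 0 < lam ^+ n by rewrite exprn_gt0.
pose P x := beta * S x <= magn (H x) * lam ^+ depth x.
have [Po _] : P o /\ forall x, x \in inside C' -> P x.
  apply: (cutset_ind treeT degT cC') => [x xC|x xin Py].
    by rewrite /P /S sum_cutset_below// ler_wpM2r ?(ltW (lamX _))// betaC'.
  apply: (@le_trans _ _ (lam * A x * lam ^+ depth x)); last first.
    rewrite ler_wpM2r ?(ltW (lamX _))// step ?betain//.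
    exact: (fsubsetP subC').
  rewrite /S -(sum_children treeT degT _ cC' xin) mulr_sumr mulrAC -exprS.
  rewrite /A mulr_sumr big_seq [leRHS]big_seq; apply: ler_sum => y.
  rewrite mem_children// => xy; rewrite -(depth_child treeT xy) [leRHS]mulrC.
  exact: Py.
have := root_deviation_ge u0 cC oC HM.
have oin := root_inside treeT degT cC oC.
move: Po; rewrite /P depth_root// expr0 mulr1 (magn_message_inside q_gt1 clockM HM oin).
rewrite /S sum_below_root => Po h; rewrite ler_pdivrMr// [leRHS]mulrC.
have h0 : 0 <= magn (message_product H o).
  apply: magn_ge0 => // [k|]; first exact: (message_product_gt0 _ _ HM).
  exact: (message_product_mono _ HM).
apply: le_trans (ler_wpM2l (ltW beta0) (large _ cC')) _.
apply: le_trans Po _; apply: le_trans h.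
by rewrite ler_piMl ?(ltW L1).
Qed.

End RobustPhaseTransition.

Theorem proposition2p5 (R : realType)
  (V : choiceType) (adj : rel V) (o : V)
  (treeT : is_tree adj)
  (infT : infinite_set [set: V])
  (degT : bounded_degree adj)
  (q : nat) (q_ge2 : (2 <= q)%N)
  (M : 'M[R]_((Zp_trunc q).+2))
  (clockM : clock_transfer_matrix M)
  (M_eig_ge0 : forall a : R, eigenvalue M a -> 0 <= a)
  (lambda1 : R)
  (lambda1P : second_largest_eigenvalue M lambda1) :
  (1 < lambda1 * branching_number adj o R -> robust_phase_transition adj o M) /\
  (lambda1 * branching_number adj o R < 1 -> ~ robust_phase_transition adj o M).
Proof.
have L0 : 0 <= lambda1 by case: lambda1P => + _ _; exact: M_eig_ge0.
have lamE := second_largest_eigenvalueE q_ge2 clockM lambda1P.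
rewrite /branching_number; set br := sup _.
set W := fun (l : R) => [set \sum_(v <- C) l ^- gdist adj o v | C in cutset adj o].
have Wlb l : 0 < l -> has_lbound (W l).
  move=> l0; exists 0 => _ [C _ <-]; apply: sumr_ge0 => v _.
  by rewrite invr_ge0 exprn_ge0// ltW.
have W0 l : W l !=set0.
  by exists (\sum_(v <- [fset o]%fset) l ^- gdist adj o v); exists [fset o]%fset => //; exact: root_cutset.
have dev_ge0 u C : 0 <= root_deviation adj o M u C.
  by rewrite /root_deviation bigmax_ge_id.
split=> [br1|br1].
  have l0 : 0 < lambda1.
    by rewrite lt_neqAle L0 andbT; apply: contraTneq br1 => <-; rewrite mul0r ltr10.
  have br0 : lambda1^-1 < br by rewrite -[ltLHS]mul1r ltr_pdivrMr// mulrC.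
  (* The default [sup] of the empty set is 0, which cannot exceed [lambda1^-1]. *)
  have ne : [set l : R | 0 < l /\ 0 < inf (W l)] !=set0.
    apply/set0P/negP => /eqP e0; move: br0.
    by rewrite /br e0 sup0 ltNge invr_ge0 L0.
  have [mu [mu0 imu] lmu] := sup_gt ne br0.
  have mulam : mu^-1 < cos_eigenvalue M.
    by rewrite -lamE -[lambda1]invrK ltf_pV2 ?posrE ?invr_gt0.
  have large C : cutset adj o C -> inf (W mu) <= \sum_(v <- C) mu^-1 ^+ gdist adj o v.
    move=> cC; apply: ge_inf; first exact: Wlb.
    by exists C => //; apply: eq_bigr => v _; rewrite exprVn.
  move=> u u0 u1.
  have imu0 : 0 < mu^-1 by rewrite invr_gt0.
  have [b b0 hb] := robust_deviation_bound treeT degT q_ge2 clockM imu0 mulam imu large u0.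
  rewrite gt_eqF//; apply: lt_le_trans b0 _; apply: lb_le_inf.
    (* [lb_le_inf] needs a nonempty set, and the sphere of radius 1 is a cutset avoiding the
       root. *)
    exists (root_deviation adj o M u (sphere adj o 1)).
    exists (sphere adj o 1) => //; split; first exact: sphere_cutset.
    by rewrite mem_sphere// depth_root.
  by move=> _ [C [cC oC] <-]; exact: hb.
have br0 : 0 <= br.
  rewrite /br; have [->|/set0P[l ll]] := eqVneq [set l : R | 0 < l /\ 0 < inf (W l)] set0.
    by rewrite sup0.
  apply: le_trans (ltW ll.1) _; apply: ub_le_sup => //.
  by have [D hD] := branching_set_bounded o treeT degT R; exists D => x [x0 x1]; exact: hD.
(* With [t] the added fraction, [t * br < t * (br + 1) = 1 - lambda1 * br], whence [lam * br < 1].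
   The denominator [br + 1] is safe when only [0 <= br] is known. *)
pose lam := lambda1 + (1 - lambda1 * br) / (br + 1).
have t0 : 0 < (1 - lambda1 * br) / (br + 1) by rewrite divr_gt0 ?subr_gt0// ltr_wpDl.
have Llam : cos_eigenvalue M < lam by rewrite -lamE ltrDl.
have lam0 : 0 < lam by rewrite ltr_wpDl.
have lambr : lam * br < 1.
  have tE : (1 - lambda1 * br) / (br + 1) * (br + 1) = 1 - lambda1 * br.
    by rewrite divfK// gt_eqF// ltr_wpDl.
  by rewrite /lam; nra.
(* [lam^-1] lies above the supremum [br], so it cannot be admissible. *)
have inf0 : inf (W lam^-1) <= 0.
  rewrite leNgt; apply/negP => i0; move: lambr; rewrite ltNge => /negP; apply.
  rewrite mulrC -ler_pdivrMr// div1r; apply: ub_le_sup => //; last by split; [rewrite invr_gt0 | exact: i0].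
  by have [D hD] := branching_set_bounded o treeT degT R; exists D => x [x0 x1]; exact: hD.
have small e : 0 < e -> exists2 C, cutset adj o C & \sum_(v <- C) lam ^+ gdist adj o v < e.
  move=> e0; have [_ [C cC <-] h] := inf_lt (W0 _) (le_lt_trans inf0 e0).
  exists C => //; apply: le_lt_trans h; rewrite le_eqVlt; apply/orP; left; apply/eqP.
  by apply: eq_bigr => v _; rewrite exprVn invrK.
rewrite lamE in L0.
have [u [u0 u1 hu]] := no_robust_phase_transition treeT degT q_ge2 clockM L0 Llam small.
(* For this [u] the deviations are nonnegative and arbitrarily small, so their infimum is exactly
   0. *)
move=> /(_ u u0 u1) /eqP; apply; apply/eqP; rewrite eq_le; apply/andP; split.
  rewrite leNgt; apply/negP => /hu[C [cC oC]]; rewrite ltNge => /negP; apply.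
  apply: ge_inf; last by exists C.
  by exists 0 => _ [C' _ <-].
have [C [cC oC _]] := hu 1 ltr01.
apply: lb_le_inf; first by exists (root_deviation adj o M u C); exists C.
by move=> _ [C' _ <-].
Qed.
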